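(* Let $\mathcal C$ be a category endowed with a cosimplicial object $\mathcal O:\mathbf\Delta\to\mathcal C$ that permits a Theorem A. Let $f:X\to Y$, $g:X\to Z$ and $h:Y\to Z$ be morphisms of $\mathcal C$ with $hf=g$. If for every $0$-simplex $z$ of $N(Z)$ the morphism $z\backslash N(f): z\backslash N(X)\to z\backslash N(Y)$ is a weak equivalence of simplicial sets, then $f$ is a weak equivalence of $\mathcal C$.
   Context: $\mathbf\Delta$ is the simplex category with objects $\Delta_m=\{0<\dots<m\}$, $m\ge0$. Weak equivalences of simplicial sets are weak homotopy equivalences. For an $m$-simplex $x$ of a simplicial set and $0\le i_0<\dots<i_p\le m$, $x_{i_0,\dots,i_p}$ denotes the $p$-simplex obtained by restriction along $\Delta_p\to\Delta_m$, $k\mapsto i_k$. Simplicial slices. For a morphism of simplicial sets $g:X\to Z$ and an $m$-simplex $z$ of $Z$, $z\backslash X$ is the simplicial set with $(z\backslash X)_n=\{(x\in X_n,\ z'\in Z_{m+1+n}) \mid z'_{0,\dots,m}=z,\ z'_{m+1,\dots,m+1+n}=g(x)\}$, with the evident simplicial operations. If $f:X\to Y$ is a morphism over $Z$, $z\backslash f:z\backslash X\to z\backslash Y$ is $(x,z')\mapsto(f(x),z')$. Given a cosimplicial object $\mathcal O:\mathbf\Delta\to\mathcal C$, put $\mathcal O_n=\mathcal O(\Delta_n)$; the nerve $N:\mathcal C\to\widehat{\mathbf\Delta}$ (simplicial sets) is $N(X)_n=\mathrm{Hom}_{\mathcal C}(\mathcal O_n,X)$. A morphism of $\mathcal C$ is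 a weak equivalence if its image under $N$ is a weak equivalence of simplicial sets. For morphisms of $\mathcal C$ with target $Z$, slices of their nerves are taken relative to the induced maps to $N(Z)$. The cosimplicial object $\mathcal O$ permits a Theorem A if for every morphism $g:X\to Z$ of $\mathcal C$, every $m\ge0$ and every $m$-simplex $z$ of $N(Z)$, the morphism $z\backslash N(X)\to z_m\backslash N(X)$ given on $n$-simplices by $(x,z')\mapsto(x,z'_{m,\dots,m+1+n})$ is a weak equivalence of simplicial sets. *)

(* Defs.v *)
From HB Require Import structures.
From Stdlib Require Import Relation_Operators.
From mathcomp Require Import all_boot.
From mathcomp Require Import boolp.

Set Implicit Arguments.
Unset Strict Implicit.
Unset Printing Implicit Defensive.

Record category := Category {
  Ob :> Type;
  Hom : Ob -> Ob -> Type;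
  idc : forall A, Hom A A;
  compc : forall A B D, Hom B D -> Hom A B -> Hom A D;
  compc1 : forall A B (f : Hom A B), compc f (idc A) = f;
  comp1c : forall A B (f : Hom A B), compc (idc B) f = f;
  compcA : forall A B D E (h : Hom D E) (g : Hom B D) (f : Hom A B),
    compc h (compc g f) = compc (compc h g) f }.

Arguments Hom {c} _ _.
Arguments idc {c} A.
Arguments compc {c A B D} _ _.

Record functor (C D : category) := Functor {
  fobj :> C -> D;
  fmap : forall A B, Hom A B -> Hom (fobj A) (fobj B);
  fmap_id : forall A, fmap (idc A) = idc (fobj A);
  fmap_comp : forall A B E (g : Hom B E) (f : Hom A B),
    fmap (compc g f) = compc (fmap g) (fmap f) }.

(* The object Delta_m is represented by m, and its underlying ordered set     *)
(* {0 < ... < m} by 'I_m.+1.                                                  *)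
Record mono (m n : nat) := Mono {
  mono_fun :> {ffun 'I_m.+1 -> 'I_n.+1};
  monoP : [forall i : 'I_m.+1, forall j : 'I_m.+1,
             (i <= j) ==> (mono_fun i <= mono_fun j)] }.

HB.instance Definition _ m n := [isSub for @mono_fun m n].

Lemma mono_leq m n (f : mono m n) (i j : 'I_m.+1) : i <= j -> f i <= f j.
Proof. by move/forallP: (monoP f) => /(_ i)/forallP/(_ j)/implyP; apply. Qed.

Lemma mono_ext m n (f g : mono m n) : f =1 g -> f = g.
Proof. by move=> E; apply/val_inj/ffunP. Qed.

Lemma mk_monoP m n (f : 'I_m.+1 -> 'I_n.+1)
    (fP : forall i j : 'I_m.+1, i <= j -> f i <= f j) :
  [forall i : 'I_m.+1, forall j : 'I_m.+1,
    (i <= j) ==> ([ffun x => f x] i <= [ffun x => f x] j)].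
Proof. by apply/'forall_forallP => i j; apply/implyP => ij; rewrite !ffunE fP. Qed.

Definition mk_mono m n (f : 'I_m.+1 -> 'I_n.+1)
    (fP : forall i j : 'I_m.+1, i <= j -> f i <= f j) : mono m n :=
  Mono (mk_monoP fP).

Lemma mk_monoE m n (f : 'I_m.+1 -> 'I_n.+1) fP i :
  @mk_mono m n f fP i = f i.
Proof. by rewrite ffunE. Qed.

Definition mono_id m : mono m m := @mk_mono m m id (fun _ _ => id).

Definition mono_comp m n p (g : mono n p) (f : mono m n) : mono m p :=
  @mk_mono m p (g \o f) (fun i j ij => mono_leq g (mono_leq f ij)).

Definition mono_const m n (i : 'I_n.+1) : mono m n :=
  @mk_mono m n (fun=> i) (fun _ _ _ => leqnn i).

Lemma mono_idE m i : mono_id m i = i.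
Proof. exact: mk_monoE. Qed.

Lemma mono_compE m n p (g : mono n p) (f : mono m n) i :
  mono_comp g f i = g (f i).
Proof. exact: mk_monoE. Qed.

Lemma mono_constE m n i j : @mono_const m n i j = i.
Proof. exact: mk_monoE. Qed.

Lemma mono_comp1 m n (f : mono m n) : mono_comp f (mono_id m) = f.
Proof. by apply: mono_ext => i; rewrite mono_compE mono_idE. Qed.

Lemma mono_1comp m n (f : mono m n) : mono_comp (mono_id n) f = f.
Proof. by apply: mono_ext => i; rewrite mono_compE mono_idE. Qed.

Lemma mono_compA m n p q (h : mono p q) (g : mono n p) (f : mono m n) :
  mono_comp h (mono_comp g f) = mono_comp (mono_comp h g) f.
Proof. by apply: mono_ext => i; rewrite !mono_compE. Qed.

Definition Delta : category :=
  Category mono_comp1 mono_1comp mono_compA.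

Record sset := SSet {
  simp :> nat -> Type;
  act : forall m n, mono m n -> simp n -> simp m;
  act_id : forall n (x : simp n), act (mono_id n) x = x;
  act_comp : forall m n p (g : mono n p) (f : mono m n) (x : simp p),
    act (mono_comp g f) x = act f (act g x) }.

Arguments act {s m n} _ _.

Record smap (X Y : sset) := SMap {
  smap_fun :> forall n, X n -> Y n;
  smap_nat : forall m n (a : mono m n) (x : X n),
    smap_fun (act a x) = act a (smap_fun x) }.

Arguments smap_fun {X Y} _ n _.

Lemma smap_comp_nat X Y Z (g : smap Y Z) (f : smap X Y) m n (a : mono m n)
  (x : X n) : g _ (f _ (act a x)) = act a (g _ (f _ x)).
Proof. by rewrite !smap_nat. Qed.

Definition smap_comp X Y Z (g : smap Y Z) (f : smap X Y) : smap X Z :=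
  SMap (smap_comp_nat g f).

Definition stdsimplex (n : nat) : sset :=
  @SSet (fun m => mono m n) (fun _ _ a x => mono_comp x a)
    (fun _ x => mono_comp1 x) (fun _ _ _ g f x => mono_compA x g f).

(* The horn Lambda^n_k: the simplices of Delta^n that miss some vertex other  *)
(* than k.                                                                    *)
Definition in_horn n (k : 'I_n.+1) m (x : mono m n) : bool :=
  [exists i, (i != k) && (i \notin codom x)].

Lemma in_horn_act n (k : 'I_n.+1) l m (a : mono l m) (x : mono m n) :
  in_horn k x -> in_horn k (mono_comp x a).
Proof.
case/existsP=> i /andP[ik ix]; apply/existsP; exists i; rewrite ik /=.
by apply: contra ix => /codomP[j ->]; rewrite mono_compE codom_f.
Qed.

Definition horn_act n (k : 'I_n.+1) l m (a : mono l m)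
    (x : {x : mono m n | in_horn k x}) : {x : mono l n | in_horn k x} :=
  exist _ (mono_comp (val x) a) (in_horn_act a (valP x)).

Lemma horn_act_id n (k : 'I_n.+1) m (x : {x : mono m n | in_horn k x}) :
  horn_act (mono_id m) x = x.
Proof. by apply: val_inj; rewrite /= mono_comp1. Qed.

Lemma horn_act_comp n (k : 'I_n.+1) l m p (g : mono m p) (f : mono l m)
    (x : {x : mono p n | in_horn k x}) :
  horn_act (mono_comp g f) x = horn_act f (horn_act g x).
Proof. by apply: val_inj; rewrite /= mono_compA. Qed.

Definition horn n (k : 'I_n.+1) : sset :=
  SSet (@horn_act_id n k) (@horn_act_comp n k).

Definition Kan (K : sset) : Prop :=
  forall n (k : 'I_n.+2) (u : smap (horn k) K),
    exists v : smap (stdsimplex n.+1) K,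
      forall m (x : horn k m), v m (val x) = u m x.

Section Product.
Variables X Y : sset.

Definition sprod_act m n (a : mono m n) (p : X n * Y n) : X m * Y m :=
  (act a p.1, act a p.2).

Lemma sprod_act_id n p : sprod_act (mono_id n) p = p.
Proof. by case: p => x y; rewrite /sprod_act !act_id. Qed.

Lemma sprod_act_comp m n p (g : mono n p) (f : mono m n) x :
  sprod_act (mono_comp g f) x = sprod_act f (sprod_act g x).
Proof. by rewrite /sprod_act !act_comp. Qed.

Definition sprod : sset := SSet sprod_act_id sprod_act_comp.

End Product.

(* u and v are joined by an edge of the simplicial set of maps Fun(X, K).     *)
Definition elem_homotopic (X K : sset) (u v : smap X K) : Prop :=
  exists H : smap (sprod X (stdsimplex 1)) K,
    forall n (x : X n),
      H n (x, mono_const n ord0) = u n x /\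
      H n (x, mono_const n ord_max) = v n x.

(* u and v have the same class in pi_0(Fun(X, K)).                            *)
Definition homotopic (X K : sset) : smap X K -> smap X K -> Prop :=
  clos_refl_sym_trans (smap X K) (@elem_homotopic X K).

(* Precomposition with f induces a bijection                                  *)
(* pi_0(Fun(Y, K)) -> pi_0(Fun(X, K)) for every Kan complex K. This is the    *)
(* combinatorial definition of weak homotopy equivalences (Joyal-Tierney,     *)
(* Kerodon); it avoids geometric realizations and choices of base points.     *)
Definition weak_equiv (X Y : sset) (f : smap X Y) : Prop :=
  forall K : sset, Kan K ->
    (forall v w : smap Y K,
       homotopic (smap_comp v f) (smap_comp w f) -> homotopic v w) /\
    (forall u : smap X K, exists v : smap Y K, homotopic (smap_comp v f) u).

(* The ordinal sum of Delta_m and Delta_n is Delta_(m+1+n). Its index is      *)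
(* written m + n.+1, so that its underlying set is definitionally             *)
(* 'I_(m.+1 + n.+1), with lshift and rshift as inclusions of the summands.    *)
Lemma front_leq m n (i j : 'I_m.+1) :
  i <= j -> lshift n.+1 i <= lshift n.+1 j.
Proof. by []. Qed.

Definition front m n : mono m (m + n.+1) :=
  @mk_mono m (m + n.+1) (@lshift m.+1 n.+1) (@front_leq m n).

Lemma frontE m n i : front m n i = lshift n.+1 i.
Proof. exact: mk_monoE. Qed.

Lemma back_leq m n (i j : 'I_n.+1) :
  i <= j -> rshift m.+1 i <= rshift m.+1 j.
Proof. by rewrite /= leq_add2l. Qed.

Definition back m n : mono n (m + n.+1) :=
  @mk_mono n (m + n.+1) (@rshift m.+1 n.+1) (@back_leq m n).

Lemma backE m n i : back m n i = rshift m.+1 i.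
Proof. exact: mk_monoE. Qed.

Section Join.
Variables (m m' n n' : nat) (a : mono m m') (b : mono n n').

Definition join_fun (i : 'I_(m.+1 + n.+1)) : 'I_(m'.+1 + n'.+1) :=
  match split i with
  | inl j => lshift n'.+1 (a j)
  | inr j => rshift m'.+1 (b j)
  end.

Lemma join_leq (i j : 'I_(m.+1 + n.+1)) : i <= j -> join_fun i <= join_fun j.
Proof.
rewrite /join_fun; case: splitP => k ->; case: splitP => l -> kl /=.
- exact: mono_leq.
- by apply: leq_trans (leq_addr _ _); apply: ltnW.
- by move: kl; rewrite leqNgt (leq_trans (ltn_ord l)) ?leq_addr.
- by rewrite leq_add2l mono_leq // -(leq_add2l m.+1).
Qed.

Definition mono_join : mono (m + n.+1) (m' + n'.+1) :=
  @mk_mono (m + n.+1) (m' + n'.+1) join_fun join_leq.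

Lemma mono_joinE i : mono_join i = join_fun i.
Proof. exact: mk_monoE. Qed.

Lemma join_lshift j : join_fun (lshift n.+1 j) = lshift n'.+1 (a j).
Proof. by rewrite /join_fun (unsplitK (inl j)). Qed.

Lemma join_rshift j : join_fun (rshift m.+1 j) = rshift m'.+1 (b j).
Proof. by rewrite /join_fun (unsplitK (inr j)). Qed.

Lemma join_front : mono_comp mono_join (front m n) = mono_comp (front m' n') a.
Proof. by apply: mono_ext => i; rewrite !mono_compE mono_joinE !frontE join_lshift. Qed.

Lemma join_back : mono_comp mono_join (back m n) = mono_comp (back m' n') b.
Proof. by apply: mono_ext => i; rewrite !mono_compE mono_joinE !backE join_rshift. Qed.

End Join.

Lemma join_id m n : mono_join (mono_id m) (mono_id n) = mono_id (m + n.+1).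
Proof.
apply: mono_ext => i; rewrite mono_joinE mono_idE.
by case: (@split_ordP m.+1 n.+1 i) => j ->; rewrite /= ?join_lshift ?join_rshift mono_idE.
Qed.

Lemma join_comp m n m' n' m'' n'' (a' : mono m' m'') (b' : mono n' n'')
    (a : mono m m') (b : mono n n') :
  mono_join (mono_comp a' a) (mono_comp b' b) =
  mono_comp (mono_join a' b') (mono_join a b).
Proof.
apply: mono_ext => i; rewrite mono_compE !mono_joinE.
by case: (@split_ordP m.+1 n.+1 i) => j ->; rewrite /= ?join_lshift ?join_rshift mono_compE.
Qed.

Section Slice.
Variables (X Z : sset) (g : smap X Z) (m : nat) (z : Z m).

Record slice_simplex (n : nat) := SliceSimplex {
  sl_x : X n;
  sl_z : Z (m + n.+1);
  sl_front : act (front m n) sl_z = z;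
  sl_back : act (back m n) sl_z = g n sl_x }.

Lemma slice_ext n (s t : slice_simplex n) :
  sl_x s = sl_x t -> sl_z s = sl_z t -> s = t.
Proof.
case: s t => [x z' F B] [y w F' B'] /= E1 E2; subst y w.
by rewrite (Prop_irrelevance F F') (Prop_irrelevance B B').
Qed.

Lemma slice_act_front p n (a : mono p n) (s : slice_simplex n) :
  act (front m p) (act (mono_join (mono_id m) a) (sl_z s)) = z.
Proof. by rewrite -act_comp join_front mono_comp1 sl_front. Qed.

Lemma slice_act_back p n (a : mono p n) (s : slice_simplex n) :
  act (back m p) (act (mono_join (mono_id m) a) (sl_z s)) =
  g p (act a (sl_x s)).
Proof. by rewrite -act_comp join_back act_comp sl_back smap_nat. Qed.

Definition slice_act p n (a : mono p n) (s : slice_simplex n) :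
    slice_simplex p :=
  SliceSimplex (slice_act_front a s) (slice_act_back a s).

Lemma slice_act_id n s : slice_act (mono_id n) s = s.
Proof. by apply: slice_ext; rewrite /= ?join_id act_id. Qed.

Lemma slice_act_comp p q n (b : mono q n) (a : mono p q) s :
  slice_act (mono_comp b a) s = slice_act a (slice_act b s).
Proof.
apply: slice_ext; rewrite /= -act_comp -?join_comp ?mono_comp1 //.
Qed.

Definition slice : sset := SSet slice_act_id slice_act_comp.

End Slice.

(* f is a morphism over Z from g to h.                                        *)
Definition over (X Y Z : sset) (f : smap X Y) (g : smap X Z) (h : smap Y Z) :=
  forall n (x : X n), h n (f n x) = g n x.

Section SliceMap.
Variables (X Y Z : sset) (f : smap X Y) (g : smap X Z) (h : smap Y Z).
Variables (fgh : over f g h) (m : nat) (z : Z m).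

Lemma slice_map_back n (s : slice g z n) :
  act (back m n) (sl_z s) = h n (f n (sl_x s)).
Proof. by rewrite sl_back fgh. Qed.

Definition slice_map_fun n (s : slice g z n) : slice h z n :=
  SliceSimplex (sl_front s) (slice_map_back s).

Lemma slice_map_nat p n (a : mono p n) (s : slice g z n) :
  slice_map_fun (act a s) = act a (slice_map_fun s).
Proof. by apply: slice_ext; rewrite /= ?smap_nat. Qed.

Definition slice_map : smap (slice g z) (slice h z) := SMap slice_map_nat.

End SliceMap.

Section SliceVertex.
Variables (X Z : sset) (g : smap X Z) (m : nat) (z : Z m).

Definition last_vertex : Z 0 := act (mono_const 0 ord_max) z.

(* k |-> m + k, see tailE.                                                    *)
Definition tail n : mono (0 + n.+1) (m + n.+1) :=
  mono_join (mono_const 0 ord_max) (mono_id n).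

Lemma tailE n (k : 'I_n.+2) : tail n k = m + k :> nat.
Proof.
rewrite mono_joinE /join_fun; case: splitP => j ->.
  by rewrite /= mono_constE ord1 addn0.
by rewrite /= mono_idE addnCA.
Qed.

Lemma slice_vertex_front n (s : slice g z n) :
  act (front 0 n) (act (tail n) (sl_z s)) = last_vertex.
Proof. by rewrite -act_comp join_front act_comp sl_front. Qed.

Lemma slice_vertex_back n (s : slice g z n) :
  act (back 0 n) (act (tail n) (sl_z s)) = g n (sl_x s).
Proof. by rewrite -act_comp join_back mono_comp1 sl_back. Qed.

Definition slice_vertex_fun n (s : slice g z n) : slice g last_vertex n :=
  SliceSimplex (slice_vertex_front s) (slice_vertex_back s).

Lemma slice_vertex_nat p n (a : mono p n) (s : slice g z n) :
  slice_vertex_fun (act a s) = act a (slice_vertex_fun s).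
Proof.
by apply: slice_ext; rewrite //= -!act_comp -!join_comp !mono_comp1 !mono_1comp.
Qed.

Definition slice_vertex : smap (slice g z) (slice g last_vertex) :=
  SMap slice_vertex_nat.

End SliceVertex.

Section Nerve.
Variables (C : category) (O : functor Delta C).

Definition nerve_act (X : C) m n (a : mono m n) (x : Hom (O n) X) :
    Hom (O m) X :=
  compc x (fmap O (a : @Hom Delta m n)).

Lemma nerve_act_id (X : C) n (x : Hom (O n) X) :
  nerve_act (mono_id n) x = x.
Proof. by rewrite /nerve_act (@fmap_id _ _ O n) compc1. Qed.

Lemma nerve_act_comp (X : C) m n p (b : mono n p) (a : mono m n)
    (x : Hom (O p) X) :
  nerve_act (mono_comp b a) x = nerve_act a (nerve_act b x).
Proof.
by rewrite /nerve_act (@fmap_comp _ _ O m n p b a) compcA.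
Qed.

Definition nerve (X : C) : sset := SSet (@nerve_act_id X) (@nerve_act_comp X).

Definition nerve_map (X Y : C) (f : Hom X Y) : smap (nerve X) (nerve Y) :=
  @SMap (nerve X) (nerve Y) (fun n x => compc f x)
    (fun m n a x => compcA f x (fmap O (a : @Hom Delta m n))).

Lemma nerve_over (X Y Z : C) (f : Hom X Y) (g : Hom X Z) (h : Hom Y Z) :
  compc h f = g -> over (nerve_map f) (nerve_map g) (nerve_map h).
Proof. by move=> <- n x; rewrite /= compcA. Qed.

Definition cweak_equiv (X Y : C) (f : Hom X Y) : Prop :=
  weak_equiv (nerve_map f).

Definition permits_theorem_A : Prop :=
  forall (X Z : C) (g : Hom X Z) (m : nat) (z : nerve Z m),
    weak_equiv (slice_vertex (nerve_map g) z).

End Nerve.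

(* Main.v *)
(* Let S(X) be the bisimplicial set whose (m, n)-simplices are the pairs       *)
(* (x, z') with x in X_n, z' in Z_(m+1+n) and z'_(m+1..m+1+n) = g(x). Its      *)
(* m-th row is the coproduct of the slices z\X over z in Z_m, so Theorem A and *)
(* 2-out-of-3 make S(X) -> S(Y) a weak equivalence on rows. For fixed n, the   *)
(* column S(X)_(.,n) is augmented over the set X_n and has an extra            *)
(* degeneracy, so S(X) -> X is a weak equivalence on columns. The diagonal     *)
(* lemma, applied in both directions, and 2-out-of-3 give the theorem.         *)
(*                                                                            *)
(* The diagonal lemma is proved by embedding S(X) in S(Y) x J, with J          *)
(* contractible, and then by induction over the skeleta in one direction,      *)
(* whose cells are attached along pushout products with the boundary of a      *)
(* simplex. Acyclic cofibrations are handled through lifting properties        *)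
(* against K -> pt and K^I -> K x K for all Kan complexes K.                   *)

From Stdlib Require Import Relation_Operators.
From mathcomp Require Import all_boot boolp zify.
Require Import Defs.

Set Implicit Arguments.
Unset Strict Implicit.
Unset Printing Implicit Defensive.

(** Row m of [slices g] is the coproduct of the slices [z\X] over all m-simplices z
    ([slice_in_coprod]). Its column n deformation retracts onto the discrete set X_n
    ([slices_proj_weq]). By the diagonal lemma [weq_diag], the columns identify the diagonal of
    [slices g] with X up to weak equivalence, and the rows make the map of diagonals induced by f a
    weak equivalence once f is one on every slice; two out of three then gives f ([weq_of_slices]).
    Theorem A serves to pass from slices under vertices to slices under all simplices
    ([slice_map_vertex]).

    The substance is the diagonal lemma, for weak equivalences that are defined by homotopy classes
    of maps into Kan complexes. Two out of three is immediate, and stability under products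
    ([weq_prod]) holds because K^D is Kan ([Kan_sexp]). Stability under gluing comes from [acofP]:
    an injection is a weak equivalence exactly when it lifts against K -> pt and K^I -> K x K for
    all Kan K, and lifting passes to pushouts and countable unions. This rests on homotopy extension
    ([HEP]), hence on cutting a prism into horn fillings.

    For a sub-bisimplicial set that is acyclic on rows, the latching inclusions are acyclic
    ([latch_acof]), so are their pushout products with boundaries ([acof_box]), and the cells of the
    skeletal filtration then give [acof_diag]. An arbitrary map reduces to this case by an embedding
    into a product with a contractible factor. *)

Lemma smap_ext X Y (f g : smap X Y) : (forall n x, f n x = g n x) -> f = g.
Proof.
case: f g => [f Hf] [g Hg] /= E.
have fg : f = g.
  by apply: functional_extensionality_dep => n; apply/funext => x; apply: E.
by subst g; rewrite (Prop_irrelevance Hf Hg).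
Qed.

(** The gluing principle for pushouts, unions and coproducts: values are prescribed by a relation,
    and uniqueness makes the chosen values natural. *)
Lemma smap_of_rel (X Y : sset) (R : forall n, X n -> Y n -> Prop)
    (Rtot : forall n x, exists y, R n x y)
    (Rfun : forall n x y y', R n x y -> R n x y' -> y = y')
    (Ract : forall m n (a : mono m n) x y, R n x y -> R m (act a x) (act a y)) :
  exists f : smap X Y, forall n x, R n x (f n x).
Proof.
pose F n x := sval (cid (Rtot n x)).
have FP n x : R n x (F n x) by rewrite /F; case: cid.
have Fnat m n (a : mono m n) (x : X n) : F m (act a x) = act a (F n x).
  by apply: Rfun (FP _ _) _; apply: Ract.
by exists (SMap Fnat).
Qed.

(** * Basic maps, products and representables *)

Definition smap_id X : smap X X := @SMap X X (fun _ x => x) (fun _ _ _ _ => erefl).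

Definition sfst X Y : smap (sprod X Y) X :=
  @SMap (sprod X Y) X (fun _ p => p.1) (fun _ _ _ _ => erefl).

Definition ssnd X Y : smap (sprod X Y) Y :=
  @SMap (sprod X Y) Y (fun _ p => p.2) (fun _ _ _ _ => erefl).

Lemma spair_nat W X Y (f : smap W X) (g : smap W Y) m n (a : mono m n) (x : W n) :
  (f m (act a x), g m (act a x)) = act (s := sprod X Y) a (f n x, g n x).
Proof. by rewrite !smap_nat. Qed.

Definition spair W X Y (f : smap W X) (g : smap W Y) : smap W (sprod X Y) :=
  @SMap W (sprod X Y) (fun n x => (f n x, g n x)) (spair_nat f g).

Definition sprod_map X X' Y Y' (f : smap X X') (g : smap Y Y') :
    smap (sprod X Y) (sprod X' Y') :=
  spair (smap_comp f (sfst X Y)) (smap_comp g (ssnd X Y)).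

Definition sdisc (T : Type) : sset :=
  @SSet (fun _ => T) (fun _ _ _ x => x) (fun _ _ => erefl) (fun _ _ _ _ _ _ => erefl).

Lemma mono_const_comp m n p (e : 'I_p.+1) (a : mono m n) :
  mono_comp (mono_const n e) a = mono_const m e.
Proof. by apply: mono_ext => i; rewrite mono_compE !mono_constE. Qed.

Lemma svtx_nat (X : sset) k (e : 'I_k.+1) m n (a : mono m n) (x : X n) :
  mono_const m e = act (s := stdsimplex k) a (mono_const n e).
Proof. by rewrite /= mono_const_comp. Qed.

Definition svtx (X : sset) k (e : 'I_k.+1) : smap X (stdsimplex k) :=
  @SMap X (stdsimplex k) (fun n _ => mono_const n e) (@svtx_nat X k e).

Definition std_map m n (a : mono m n) : smap (stdsimplex m) (stdsimplex n) :=
  @SMap (stdsimplex m) (stdsimplex n) (fun _ x => mono_comp a x)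
    (fun _ _ b x => mono_compA a x b).

Definition yoneda (X : sset) n (x : X n) : smap (stdsimplex n) X :=
  @SMap (stdsimplex n) X (fun _ a => act a x) (fun _ _ a b => act_comp b a x).

(** * Simplicial subsets *)

Record sub (W : sset) := Sub {
  sub_pred :> forall n, W n -> Prop;
  sub_act : forall m n (a : mono m n) x, sub_pred x -> sub_pred (act a x) }.

Arguments sub_pred {W} s n x.

Lemma sval_inj T (P : T -> Prop) (u v : {x | P x}) : sval u = sval v -> u = v.
Proof. case: u v => [x p] [y q] /= E; subst y; by rewrite (Prop_irrelevance p q). Qed.

Section SubObject.
Variables (W : sset) (U : sub W).

Definition ssub_act m n (a : mono m n) (x : {x : W n | U n x}) : {x : W m | U m x} :=
  exist _ (act a (sval x)) (sub_act a (svalP x)).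

Lemma ssub_act_id n x : ssub_act (mono_id n) x = x.
Proof. by apply: sval_inj; rewrite /= act_id. Qed.

Lemma ssub_act_comp m n p (g : mono n p) (f : mono m n) x :
  ssub_act (mono_comp g f) x = ssub_act f (ssub_act g x).
Proof. by apply: sval_inj; rewrite /= act_comp. Qed.

Definition ssub : sset := SSet ssub_act_id ssub_act_comp.

Definition incl : smap ssub W := @SMap ssub W (fun _ x => sval x) (fun _ _ _ _ => erefl).

Lemma corestr_nat X (f : smap X W) (fU : forall n x, U n (f n x)) m n (a : mono m n) x :
  exist (U m) (f m (act a x)) (fU m (act a x)) =
  act (s := ssub) a (exist (U n) (f n x) (fU n x)).
Proof. by apply: sval_inj; rewrite /= smap_nat. Qed.

Definition corestr X (f : smap X W) (fU : forall n x, U n (f n x)) : smap X ssub :=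
  @SMap X ssub (fun n x => exist (U n) (f n x) (fU n x)) (corestr_nat fU).

End SubObject.

Arguments incl {W} U.

Definition incl_le W (U V : sub W) (UV : forall n x, U n x -> V n x) :
    smap (ssub U) (ssub V) :=
  @corestr W V (ssub U) (incl U) (fun n x => UV n _ (svalP x)).

Definition sinj X Y (f : smap X Y) := forall n, injective (f n).

Lemma incl_inj W (U : sub W) : sinj (incl U).
Proof. by move=> n x y /sval_inj. Qed.

Lemma incl_le_inj W (U V : sub W) (UV : forall n x, U n x -> V n x) :
  sinj (incl_le UV).
Proof. by move=> n x y E; apply/sval_inj/(congr1 sval E). Qed.

Lemma sprod_map_inj X X' Y Y' (f : smap X X') (g : smap Y Y') :
  sinj f -> sinj g -> sinj (sprod_map f g).
Proof. by move=> fI gI n [x y] [x' y'] /= [/fI -> /gI ->]. Qed.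

(** * Internal homs *)

Section Exp.
Variables D K : sset.

Definition sexp_act m n (a : mono m n) (u : smap (sprod (stdsimplex n) D) K) :
    smap (sprod (stdsimplex m) D) K :=
  smap_comp u (sprod_map (std_map a) (smap_id D)).

Lemma sexp_act_id n u : sexp_act (mono_id n) u = u.
Proof. by apply: smap_ext => k [a d]; rewrite /= mono_1comp. Qed.

Lemma sexp_act_comp m n p (g : mono n p) (f : mono m n) u :
  sexp_act (mono_comp g f) u = sexp_act f (sexp_act g u).
Proof. by apply: smap_ext => k [a d]; rewrite /= mono_compA. Qed.

Definition sexp : sset := SSet sexp_act_id sexp_act_comp.

Lemma sev_nat m n (a : mono m n) (p : sprod sexp D n) :
  ((act a p).1 : smap _ _) m (mono_id m, (act a p).2) =
  act a ((p.1 : smap _ _) n (mono_id n, p.2)).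
Proof. by rewrite -smap_nat /= /sprod_act /= mono_1comp mono_comp1. Qed.

Definition sev : smap (sprod sexp D) K := SMap sev_nat.

Lemma curry_nat1 (X : sset) (h : smap (sprod X D) K) n (x : X n) k l (a : mono k l)
    (p : sprod (stdsimplex n) D l) :
  h k (act (act a p).1 x, (act a p).2) = act a (h l (act p.1 x, p.2)).
Proof. by rewrite -smap_nat /= /sprod_act /= act_comp. Qed.

Definition curry_fun (X : sset) (h : smap (sprod X D) K) n (x : X n) : sexp n :=
  SMap (curry_nat1 h x).

Lemma curry_nat (X : sset) (h : smap (sprod X D) K) m n (a : mono m n) (x : X n) :
  curry_fun h (act a x) = act a (curry_fun h x).
Proof. by apply: smap_ext => k [b d] /=; rewrite act_comp. Qed.

Definition curry X (h : smap (sprod X D) K) : smap X sexp := SMap (curry_nat h).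

Definition uncurry X (h : smap X sexp) : smap (sprod X D) K :=
  smap_comp sev (sprod_map h (smap_id D)).

Lemma curryK X (h : smap (sprod X D) K) n p : uncurry (curry h) n p = h n p.
Proof. by case: p => x d; rewrite /= act_id. Qed.

Lemma uncurryE X (h : smap X sexp) n x k (d : D k) (a : mono k n) :
  (h n x : smap _ _) k (a, d) = uncurry h k (act a x, d).
Proof. by rewrite /= smap_nat /= mono_comp1. Qed.

Lemma sexp_ext X (h h' : smap X sexp) :
  (forall n x d, uncurry h n (x, d) = uncurry h' n (x, d)) -> h = h'.
Proof.
move=> E; apply: smap_ext => n x; apply: smap_ext => k [a d].
by rewrite !uncurryE E.
Qed.

End Exp.

(** * Lifting properties *)

Definition LLP A B E F (i : smap A B) (p : smap E F) :=
  forall (u : smap A E) (v : smap B F),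
    (forall n x, p n (u n x) = v n (i n x)) ->
    exists w : smap B E,
      (forall n x, w n (i n x) = u n x) /\ (forall n y, p n (w n y) = v n y).

(* A degreewise criterion for the square P -> U, Q -> V to be a pushout with  *)
(* U -> V injective.                                                          *)
Record is_po P Q U V (i : smap P Q) (a : smap P U) (j : smap U V) (b : smap Q V) :=
  IsPo {
  po_comm : forall n x, j n (a n x) = b n (i n x);
  po_inj : sinj j;
  po_cover : forall n v, (exists u, v = j n u) \/ (exists q, v = b n q);
  po_old : forall n q u, b n q = j n u -> exists x, q = i n x;
  po_new : forall n q q', b n q = b n q' -> q = q' \/ exists x, q = i n x }.

(** The given map on U and a lift on Q agree wherever their images in V overlap, by [po_old] and
    [po_new], so they glue. *)
Lemma LLP_po P Q U V (i : smap P Q) a (j : smap U V) b E F (p : smap E F) :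
  is_po i a j b -> LLP i p -> LLP j p.
Proof.
move=> po L u v uv.
have [w [wi pw]] := L (smap_comp u a) (smap_comp v b)
  (fun n x => etrans (uv n (a n x)) (congr1 (v n) (po_comm po x))).
pose R n (x : V n) (e : E n) :=
  (exists2 y, x = j n y & e = u n y) \/ (exists2 q, x = b n q & e = w n q).
have Ruw n y q : j n y = b n q -> u n y = w n q.
  move=> e; have [x xE] := po_old po (esym e); subst q.
  by rewrite wi /=; congr (u n _); apply: (po_inj po); rewrite e (po_comm po).
have [f fR] : exists f : smap V E, forall n x, R n x (f n x).
  apply: smap_of_rel => [n x|n x e e'|m n c x e].
  - by case: (po_cover po x) => [][y ->]; [exists (u n y); left|exists (w n y); right]; exists y.
  - move=> [] [y -> ->] [] [y' E1 ->].
    + by rewrite (po_inj po E1).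
    + exact: Ruw.
    + by rewrite (Ruw _ y' y).
    + case: (po_new po E1) => [-> //|[z zE]]; subst y.
      rewrite wi /=; apply: Ruw; by rewrite (po_comm po).
  - case=> [] [y -> ->]; [left; exists (act c y)|right; exists (act c y)];
    by rewrite smap_nat.
exists f; split=> [n x|n y].
  case: (fR n (j n x)) => [] [y E1 ->]; first by rewrite (po_inj po E1).
  by rewrite (Ruw _ x y).
by case: (fR n y) => [] [x -> ->]; [apply: uv|apply: pw].
Qed.

(** Lifts are extended stage by stage with dependent choice. Later lifts restrict to earlier ones
    ([gD]), so they glue on the union. *)
Lemma LLP_seq W (U : nat -> sub W) (le : forall k n x, U k n x -> U k.+1 n x)
    (cov : forall n x, exists k, U k n x) E F (p : smap E F) :
  (forall k, LLP (incl_le (le k)) p) -> LLP (incl (U 0)) p.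
Proof.
move=> L u v uv.
pose good k := {w : smap (ssub (U k)) E | forall n x, p n (w n x) = v n (sval x)}.
have next k (g : good k) : {g' : good k.+1 |
    forall n x, sval g' n (incl_le (le k) n x) = sval g n x}.
  case: g => w pw.
  have := L k w (smap_comp v (incl (U k.+1))) pw.
  by case/cid=> w' [w'i pw']; exists (exist _ w' pw').
pose g := nat_rect good (exist _ u uv) (fun k g => sval (next k g)).
have gS k n x : sval (g k.+1) n (incl_le (le k) n x) = sval (g k) n x.
  exact: (svalP (next k (g k))).
have leD k d n x : U k n x -> U (d + k) n x.
  by elim: d => // d IH /IH /le.
have gD k d n x (Ux : U k n x) (Ux' : U (d + k) n x) :
    sval (g (d + k)) n (exist _ x Ux') = sval (g k) n (exist _ x Ux).
  elim: d Ux' => [|d IH] Ux'; first by congr (sval (g k) n _); apply: sval_inj.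
  have Ux'' := leD k d n x Ux.
  rewrite -(IH Ux''); apply: etrans (gS (d + k) n (exist _ x Ux'')).
  by congr (sval (g _) n _); apply: sval_inj.
have g_eq k k' n x (Ux : U k n x) (Ux' : U k' n x) :
    sval (g k) n (exist _ x Ux) = sval (g k') n (exist _ x Ux').
  wlog kk' : k k' Ux Ux' / k <= k'.
    by move=> H; case: (leqP k k') => [|/ltnW] kk; [apply: H|symmetry; apply: H].
  move: Ux'; rewrite -(subnK kk') => Ux'; symmetry; exact: gD.
have [f fR] : exists f : smap W E, forall n x,
    exists k (Ux : U k n x), f n x = sval (g k) n (exist _ x Ux).
  apply: (@smap_of_rel W E (fun n x y =>
    exists k (Ux : U k n x), y = sval (g k) n (exist _ x Ux)))
    => [n x|n x y y'|m n a x y].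
  - by have [k Ux] := cov n x; exists (sval (g k) n (exist _ x Ux)), k, Ux.
  - by case=> k [Ux ->] [k' [Ux' ->]]; apply: g_eq.
  - case=> k [Ux ->]; exists k, (sub_act a Ux).
    apply: etrans (esym (smap_nat (sval (g k)) a (exist _ x Ux))) _.
    by congr (sval (g k) m _); apply: sval_inj.
exists f; split=> [n [x Ux]|n x] /=.
  by case: (fR n x) => k [Ux' ->]; apply: (g_eq k 0).
by case: (fR n x) => k [Ux' ->]; apply: (svalP (g k)).
Qed.

(** * Monotone maps *)

Definition msurj m n (a : mono m n) := forall i, exists x, a x = i.

Lemma nonsurj_factor m n (a : mono m n) : ~ msurj a ->
  exists k (c : mono m k) (d : mono k n), k < n /\ a = mono_comp d c.
Proof.
move=> /existsNP [j jP]; have {}jP x : nat_of_ord (a x) <> j by move=> /val_inj e; apply: jP; exists x.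
case: n a j jP => [|n] a j jP.
  by case: (jP ord0); rewrite !ord1.
have cP (x y : 'I_m.+1) : x <= y ->
    (inord (unbump j (a x)) : 'I_n.+1) <= (inord (unbump j (a y)) : 'I_n.+1).
  move=> /(mono_leq a) xy.
  have := jP x; have := jP y.
  have := ltn_ord (a x); have := ltn_ord (a y); have := ltn_ord j.
  by rewrite /unbump; case: (ltnP j (a x)); case: (ltnP j (a y)) => /= *; rewrite !inordK; lia.
have dP (x y : 'I_n.+1) : x <= y -> lift j x <= lift j y.
  by move=> xy; rewrite /= /bump; case: (leqP j x); case: (leqP j y) => /=; lia.
exists n, (mk_mono cP), (mk_mono dP); split=> //.
apply: mono_ext => x; rewrite mono_compE !mk_monoE; apply: val_inj => /=.
have := jP x; have := ltn_ord (a x); have := ltn_ord j.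
by rewrite /unbump /bump; case: (ltnP j (a x)) => /= *; rewrite inordK ?subn0 ?subn1; lia.
Qed.

(** Any choice of preimages is monotone, so the preimage of [a x] may be prescribed to be x. This
    freedom later separates distinct surjections by their sections. *)
Lemma msurj_section m n (a : mono m n) (x : 'I_m.+1) : msurj a ->
  exists2 d : mono n m, mono_comp a d = mono_id n & d (a x) = x.
Proof.
move=> aS; pose f i := if i == a x then x else sval (cid (aS i)).
have fP i : a (f i) = i by rewrite /f; case: eqP => [->//|_]; case: cid.
have fmono (i j : 'I_n.+1) : i <= j -> f i <= f j.
  move=> ij; rewrite leqNgt; apply/negP => fji.
  have := mono_leq a (ltnW fji); rewrite !fP => ji.
  have e : i = j by apply: val_inj; apply/eqP; rewrite eqn_leq ij ji.
  by rewrite e ltnn in fji.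
exists (mk_mono fmono); last by rewrite mk_monoE /f eqxx.
by apply: mono_ext => i; rewrite mono_compE mk_monoE mono_idE.
Qed.

Definition collapse_fun m (i : nat) (k : 'I_m.+1) : 'I_m.+1 :=
  if k == i.+1 :> nat then inord i else k.

Lemma collapse_funE m i (k : 'I_m.+1) :
  collapse_fun i k = (if k == i.+1 :> nat then i else k) :> nat.
Proof.
rewrite /collapse_fun; case: eqP => // e.
by rewrite inordK //; have := ltn_ord k; lia.
Qed.

Lemma collapse_leq m i (k l : 'I_m.+1) :
  k <= l -> collapse_fun i k <= collapse_fun i l.
Proof. by rewrite !collapse_funE; do 2 case: eqP; lia. Qed.

(* The idempotent i+1 |-> i, so that a simplex is s_i-degenerate if and only  *)
(* if it is fixed by collapse m i.                                            *)
Definition collapse m i : mono m m := mk_mono (@collapse_leq m i).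

Lemma collapseE m i k :
  collapse m i k = (if k == i.+1 :> nat then i else k) :> nat.
Proof. by rewrite mk_monoE collapse_funE. Qed.

Lemma collapse_nonsurj m i : i < m -> ~ msurj (collapse m i).
Proof.
move=> im /(_ (inord i.+1)) [x] /(congr1 val) /=.
by rewrite collapseE inordK //; case: eqP; lia.
Qed.

(** Either two consecutive vertices have the same image, or c increases by at least one at each
    step. *)
Lemma mono_strict_or m n (c : mono m n) :
  (exists2 i, i < m & mono_comp c (collapse m i) = c) \/
  (forall d (i j : 'I_m.+1), j = i + d :> nat -> c i + d <= c j).
Proof.
case: (pselect (exists2 i, i < m & mono_comp c (collapse m i) = c)) => [|N]; [by left|right].
elim=> [|d IH] i j ij.
  by rewrite addn0 (_ : i = j) //; apply: val_inj; rewrite /= ij addn0.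
have jm := ltn_ord j; have im : i + d < m by lia.
pose k : 'I_m.+1 := inord (i + d).
have kE : k = i + d :> nat by rewrite /k inordK //; lia.
have := IH i k kE; suff : c k < c j by lia.
have kj : c k <= c j by apply: mono_leq; lia.
rewrite ltn_neqAle kj andbT; apply/negP => /eqP /val_inj ckj.
case: N; exists (i + d) => //; apply: mono_ext => l; rewrite mono_compE.
case: (eqVneq (val l) (i + d).+1) => e.
  rewrite (_ : l = j); last by apply: val_inj; rewrite /= e; lia.
  by rewrite -ckj; congr (c _); apply: val_inj; rewrite /= collapseE ij; case: eqP; lia.
by congr (c _); apply: val_inj; rewrite /= collapseE; case: eqP e => /=; lia.
Qed.

Lemma mono_collapse m n (c : mono m n) : n < m ->
  exists2 i, i < m & mono_comp c (collapse m i) = c.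
Proof.
move=> nm; case: (mono_strict_or c) => // /(_ m ord0 ord_max erefl).
by have := ltn_ord (c ord_max); lia.
Qed.

Lemma mono_endo m (c : mono m m) :
  (exists2 i, i < m & mono_comp c (collapse m i) = c) \/ c = mono_id m.
Proof.
case: (mono_strict_or c) => [|H]; [by left|right].
apply: mono_ext => i; rewrite mono_idE; apply: val_inj => /=.
have := H i ord0 i erefl; have im := ltn_ord i.
have := H (m - i) i ord_max; rewrite /= => /(_ ltac:(lia)).
by have := ltn_ord (c ord_max); lia.
Qed.

(** * Bisimplicial sets *)

Record bisset := BiSSet {
  bsimp :> nat -> nat -> Type;
  bact : forall m m' n n', mono m m' -> mono n n' -> bsimp m' n' -> bsimp m n;
  bact_id : forall m n x, bact (mono_id m) (mono_id n) x = x;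
  bact_comp : forall m m' m'' n n' n'' (a' : mono m' m'') (a : mono m m')
      (b' : mono n' n'') (b : mono n n') x,
    bact (mono_comp a' a) (mono_comp b' b) x = bact a b (bact a' b' x) }.

Arguments bact {_ _ _ _ _} _ _ _.

Section BiSSetSub.
Variable T : bisset.

Lemma bact_rowcomp m m' n n' n'' (a : mono m m') (b' : mono n' n'') (b : mono n n')
    (x : T m' n'') :
  bact a (mono_comp b' b) x = bact (mono_id m) b (bact a b' x).
Proof. by rewrite -bact_comp mono_comp1. Qed.

Lemma bact_colcomp m m' m'' n (a' : mono m' m'') (a : mono m m') (x : T m'' n) :
  bact (mono_comp a' a) (mono_id n) x = bact a (mono_id n) (bact a' (mono_id n) x).
Proof. by rewrite -bact_comp mono_comp1. Qed.

Lemma row_act_comp m p q n (g : mono q n) (f : mono p q) (x : T m n) :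
  bact (mono_id m) (mono_comp g f) x = bact (mono_id m) f (bact (mono_id m) g x).
Proof. exact: bact_rowcomp. Qed.

Definition row m : sset :=
  @SSet (T m) (fun _ _ b x => bact (mono_id m) b x) (@bact_id T m) (@row_act_comp m).

Definition diag : sset :=
  @SSet (fun n => T n n) (fun _ _ a x => bact a a x) (fun n => @bact_id T n n)
    (fun _ _ _ g f x => bact_comp g f g f x).

Record bsub := BSub {
  bsub_pred :> forall m n, T m n -> Prop;
  bsub_act : forall m m' n n' (a : mono m m') (b : mono n n') x,
    bsub_pred x -> bsub_pred (bact a b x) }.

Definition row_sub (S : bsub) m : sub (row m) :=
  @Sub (row m) (fun n x => S m n x) (fun _ _ b _ => @bsub_act S _ _ _ _ (mono_id m) b _).

Definition diag_sub (S : bsub) : sub diag :=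
  @Sub diag (fun n x => S n n x) (fun _ _ a _ => @bsub_act S _ _ _ _ a a _).

Lemma latch_act (S : bsub) m j p n (b : mono p n) (x : T m n) :
  S m n x \/ (exists2 i, i < m /\ i < j & bact (collapse m i) (mono_id n) x = x) ->
  S m p (bact (mono_id m) b x) \/ (exists2 i, i < m /\ i < j &
    bact (collapse m i) (mono_id p) (bact (mono_id m) b x) = bact (mono_id m) b x).
Proof.
case=> [Sx|[i ij xE]]; [left; exact: bsub_act|right; exists i => //].
by rewrite -{2}xE -!bact_comp !mono_1comp !mono_comp1.
Qed.

(* S_m together with the simplices of T_m that are s_i-degenerate for some    *)
(* i < j; for j = m this adds the whole latching object.                      *)
Definition latch (S : bsub) m j : sub (row m) := @Sub (row m)
  (fun n x => S m n x \/ exists2 i, i < m /\ i < j & bact (collapse m i) (mono_id n) x = x)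
  (fun _ _ b _ => @latch_act S m j _ _ b _).

End BiSSetSub.

Arguments bsub_pred {T} _ m n x.

(** * Pushout products and skeleta in the first direction *)

Definition sbox_pred (B D : sset) (U : sub B) (V : sub D) n (x : sprod B D n) :=
  U n x.1 \/ V n x.2.

Lemma sbox_act (B D : sset) (U : sub B) (V : sub D) m n (a : mono m n) (x : sprod B D n) :
  sbox_pred U V x -> sbox_pred U V (act a x).
Proof. by case=> H; [left|right]; apply: sub_act. Qed.

(* The pushout product of the inclusions of U and V.                          *)
Definition sbox (B D : sset) (U : sub B) (V : sub D) : sub (sprod B D) :=
  Sub (@sbox_act B D U V).

Lemma bd_act k m n (a : mono m n) (x : mono n k) :
  ~ msurj x -> ~ msurj (act (s := stdsimplex k) a x).
Proof. by move=> N H; apply: N => i; case: (H i) => y; rewrite /= mono_compE; exists (a y). Qed.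

Definition bd k : sub (stdsimplex k) :=
  @Sub (stdsimplex k) (fun _ x => ~ msurj x) (@bd_act k).

Lemma sub_ext W (U V : sub W) : (forall n x, U n x <-> V n x) -> U = V.
Proof.
case: U V => U HU [V HV] /= E.
have UV : U = V.
  by apply: functional_extensionality_dep => n; apply/funext => x; apply/propext/E.
by subst V; rewrite (Prop_irrelevance HU HV).
Qed.

Section Skeleton.
Variables (T : bisset) (S : bsub T).

(** Relative to S, and skeletal in the first index only: x comes from some [T l n] with l < k. *)
Definition sk_pred k n (x : T n n) :=
  S n n x \/ exists l (c : mono n l) y, l < k /\ x = bact c (mono_id n) y.

Lemma sk_act k m n (a : mono m n) (x : diag T n) :
  sk_pred k x -> sk_pred k (act a x).
Proof.
case=> [Sx|[l [c [y [lk ->]]]]]; [left; exact: bsub_act|right].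
exists l, (mono_comp c a), (bact (mono_id l) a y); split=> //=.
by rewrite -!bact_comp mono_1comp mono_comp1 mono_1comp.
Qed.

Definition sk k : sub (diag T) := Sub (@sk_act k).

Lemma sk_le k n x : sk k n x -> sk k.+1 n x.
Proof. by case=> [|[l [c [y [lk ->]]]]]; [left|right; exists l, c, y; split=> //; lia]. Qed.

Lemma sk0 : sk 0 = diag_sub S.
Proof. by apply: sub_ext => n x; split=> [[|[l [c [y []]]]]|]; [|lia|left]. Qed.

Lemma cell_nat m k n (a : mono k n) (x : sprod (row T m) (stdsimplex m) n) :
  bact (act a x).2 (mono_id k) (act a x).1 =
  act (s := diag T) a (bact x.2 (mono_id n) x.1).
Proof. by rewrite /= -!bact_comp mono_1comp mono_comp1 mono_1comp. Qed.

(** The diagonal is the coend of the products T_m x Delta^m, and these are its structure maps. *)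
Definition cell m : smap (sprod (row T m) (stdsimplex m)) (diag T) :=
  @SMap (sprod (row T m) (stdsimplex m)) (diag T)
    (fun n x => bact x.2 (mono_id n) x.1) (@cell_nat m).

Lemma cell_sk m n x : sk m.+1 n (cell m n x).
Proof. by right; exists m, x.2, x.1. Qed.

Definition cell_bd m := sbox (latch S m m) (bd m).

Lemma cell_bd_sk m n (x : ssub (cell_bd m) n) : sk m n (cell m n (sval x)).
Proof.
have fac k l n' (t : T k n') (a : mono n' k) (c : mono k l) (y : T l n') :
    l < k -> t = bact c (mono_id n') y -> sk k n' (bact a (mono_id n') t).
  move=> lk ->; right; exists l, (mono_comp c a), y; split=> //.
  by rewrite -bact_comp mono_comp1.
case: x => [[t a]] /= [[St|[i [im _] tE]]|/= /nonsurj_factor [k [c [d [km ->]]]]].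
- by left; apply: bsub_act.
- have [k [c [d [km cE]]]] := nonsurj_factor (collapse_nonsurj im).
  apply: (fac _ k _ _ _ c (bact d (mono_id n) t)) => //.
  by rewrite -bact_comp -cE mono_comp1 tE.
- right; exists k, c, (bact d (mono_id n) t); split=> //.
  by rewrite -bact_comp mono_comp1.
Qed.

(** When a is onto, a section d of it recovers t from its image. An image coming from dimension l <
    m then exhibits t as an operator m -> l applied to something, and such an operator is not
    injective. *)
Lemma cell_sk_bd m n x : sk m n (cell m n x) -> cell_bd m n x.
Proof.
case: x => t a H; case: (pselect (msurj a)) => aS; last by right.
left; have [d ad _] := msurj_section ord0 aS.
have tE : t = bact d (mono_id n) (bact a (mono_id n) t).
  by rewrite -bact_comp ad mono_comp1 bact_id.
case: H => /= [St|[l [c [y [lm aE]]]]].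
  by left; rewrite tE; apply: bsub_act.
right; have [i im cE] := mono_collapse (mono_comp c d) lm; exists i => //=.
by rewrite tE aE -!bact_comp !mono_comp1 mono_compA cE.
Qed.

(* Both t and t' are recovered from the common value by sections of a, a'.    *)
Lemma cell_new m n x y : cell m n x = cell m n y -> x = y \/ cell_bd m n x.
Proof.
case: x y => t a [t' a'] E; case: (pselect (cell_bd m n (t, a))) => N; [by right|left].
have aS : msurj a by apply: contrapT => aS; apply: N; right.
have dP (d : mono m n) : mono_comp a d = mono_id m -> mono_comp a' d = mono_id m.
  move=> ad; case: (mono_endo (mono_comp a' d)) => // [[i im cE]].
  case: N; left; right; exists i => //=.
  have -> : t = bact (mono_comp a' d) (mono_id n) t'.
    have -> : t = bact d (mono_id n) (bact a (mono_id n) t).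
      by rewrite -bact_comp ad mono_comp1 bact_id.
    by move: E => /= ->; rewrite -bact_comp mono_comp1.
  by rewrite -bact_comp cE mono_comp1.
have aE : a = a'.
  apply: mono_ext => x; have [d ad dx] := msurj_section x aS.
  move: (dP d ad) => /(congr1 (fun f : mono m m => f (a x))).
  by rewrite mono_compE mono_idE dx => ->.
subst a'; congr (_, _); have [d ad _] := msurj_section ord0 aS.
have /(congr1 (bact d (mono_id n))) := E.
by rewrite /= -!bact_comp ad mono_comp1 !bact_id.
Qed.

Lemma sk_po m :
  is_po (incl (cell_bd m))
    (@corestr _ (sk m) (ssub (cell_bd m)) (smap_comp (cell m) (incl (cell_bd m)))
      (@cell_bd_sk m))
    (incl_le (@sk_le m))
    (@corestr _ (sk m.+1) _ (cell m) (@cell_sk m)).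
Proof.
split.
- by move=> n x; apply: sval_inj.
- exact: incl_le_inj.
- move=> n [x Hx]; case: (Hx) => [Sx|[l [c [y [lm xE]]]]].
    by left; exists (exist _ x (or_introl Sx)); apply: sval_inj.
  case: (eqVneq l m) => [e|ne]; [subst l; right|left].
    by exists (y, c); apply: sval_inj.
  have Hx' : sk m n x by right; exists l, c, y; split=> //; lia.
  by exists (exist _ x Hx'); apply: sval_inj.
- move=> n q [u Hu] /(congr1 sval) /= E; subst u.
  by exists (exist _ q (cell_sk_bd Hu)).
- move=> n q q' /(congr1 sval) /= /cell_new [->|H]; [by left|right].
  by exists (exist _ q H).
Qed.

Lemma LLP_diag E F (p : smap E F) :
  (forall m, LLP (incl (sbox (latch S m m) (bd m))) p) -> LLP (incl (diag_sub S)) p.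
Proof.
move=> L; rewrite -sk0; apply: (@LLP_seq _ sk (@sk_le)) => [n x|k].
  exists n.+1; right; exists n, (mono_id n), x; split=> //.
  by rewrite bact_id.
exact: (LLP_po (sk_po k)).
Qed.

End Skeleton.

(** * Path objects, and the prism as a sequence of horn attachments *)

Notation I1 := (stdsimplex 1).

Definition vx (e : bool) : 'I_2 := if e then ord_max else ord0.

Lemma vxE b : vx b = b :> nat. Proof. by case: b. Qed.

Definition sterm K : smap K (sdisc unit) :=
  @SMap K (sdisc unit) (fun _ _ => tt) (fun _ _ _ _ => erefl).

Lemma LLP_sterm A B (i : smap A B) K :
  LLP i (sterm K) <->
  (forall u : smap A K, exists w : smap B K, forall n x, w n (i n x) = u n x).
Proof.
split=> [L u|L u v _].
  by have [w [wu _]] := L u (sterm B) (fun _ _ => erefl); exists w.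
have [w wu] := L u; exists w; split=> // n y; by case: (v n y).
Qed.

Definition sev_at K e : smap (sexp I1 K) K :=
  smap_comp (sev I1 K) (spair (smap_id _) (svtx _ (vx e))).

Definition sev_ends K : smap (sexp I1 K) (sprod K K) :=
  spair (sev_at K false) (sev_at K true).

(** A bijection is a pushout of the identity of the empty simplicial set. *)
Lemma LLP_bij A B E F (i : smap A B) (p : smap E F) :
  sinj i -> (forall n y, exists x, y = i n x) -> LLP i p.
Proof.
move=> iI iS; pose emp X := @SMap (sdisc Empty_set) X
  (fun _ (x : Empty_set) => match x with end)
  (fun _ _ _ (x : Empty_set) => match x with end).
apply: (@LLP_po _ _ _ _ (smap_id (sdisc Empty_set)) (emp A) i (emp B)).
  by split=> [n []|//|n v|n []|n []]; left; apply: iS.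
by move=> u v _; exists u; split=> n; case.
Qed.

Section Prism.
Variables (n : nat) (e : bool).
Local Notation P := (sprod (stdsimplex n) I1).

Lemma vert_act k l (a : mono k l) (t : I1 l) :
  t = mono_const l (vx e) -> act a t = mono_const k (vx e).
Proof. by move=> ->; rewrite /= mono_const_comp. Qed.

Definition vert : sub I1 :=
  @Sub I1 (fun k t => t = mono_const k (vx e)) vert_act.

(* The prism is glued from the simplices with vertices                        *)
(* (0,0), ..., (j,0), (j,1), ..., (n,1), taken in decreasing order of j when   *)
(* the bottom (e = false) is given and in increasing order when the top is.   *)
Definition in_prism j k (x : P k) :=
  forall y, (x.2 y == 0 :> nat -> x.1 y <= j) /\ (x.2 y == 1 :> nat -> j <= x.1 y).

Definition prism_idx s := if e then s else n - s.

Definition prism_pred s k (x : P k) :=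
  sbox (bd n) vert k x \/ exists2 i, i < s /\ i <= n & in_prism (prism_idx i) x.

Lemma prism_act s k l (a : mono k l) (x : P l) :
  prism_pred s x -> prism_pred s (act a x).
Proof.
case=> [H|[i is_ H]]; [left; exact: sub_act|right; exists i => // y].
by have := H (a y); rewrite /= !mono_compE.
Qed.

Definition prism s : sub P := Sub (@prism_act s).

Lemma prism_le s k x : prism s k x -> prism s.+1 k x.
Proof. by case=> [|[i [si ii] H]]; [left|right; exists i => //; lia]. Qed.

Lemma prism1_leq j (jn : j <= n) (x y : 'I_n.+2) : x <= y ->
  (inord (if x <= j then x : nat else x.-1) : 'I_n.+1) <=
  (inord (if y <= j then y : nat else y.-1) : 'I_n.+1).
Proof.
move=> xy; have := ltn_ord x; have := ltn_ord y.
case: (leqP x j); case: (leqP y j) => /= *; rewrite !inordK; lia.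
Qed.

Lemma prism2_leq j (x y : 'I_n.+2) : x <= y -> vx (j < x) <= vx (j < y).
Proof. by move=> xy; rewrite !vxE; case: (ltnP j x) => //= jx; rewrite (leq_trans jx xy). Qed.


Section Step.
Variables (s : nat) (sn : s <= n).
Let j := prism_idx s.

Let jn : j <= n. Proof. by rewrite /j /prism_idx; case: e; lia. Qed.

Definition prism_cell : smap (stdsimplex n.+1) P :=
  yoneda ((mk_mono (prism1_leq jn), mk_mono (@prism2_leq j)) : P n.+1).

Lemma prism_cell1 k (c : mono k n.+1) x :
  (prism_cell k c).1 x = (if c x <= j then c x : nat else (c x).-1) :> nat.
Proof.
rewrite (_ : (prism_cell k c).1 x = mono_comp (mk_mono (prism1_leq jn)) c x) //.
rewrite mono_compE mk_monoE inordK //.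
by have := ltn_ord (c x); case: (leqP (c x) j); lia.
Qed.

Lemma prism_cell2 k (c : mono k n.+1) x :
  (prism_cell k c).2 x = (j < c x) :> nat.
Proof.
rewrite (_ : (prism_cell k c).2 x = mono_comp (mk_mono (@prism2_leq j)) c x) //.
by rewrite mono_compE mk_monoE vxE.
Qed.

Lemma prism_cell_inj : sinj prism_cell.
Proof.
move=> k c c' E; apply: mono_ext => x; apply: val_inj => /=.
have := congr1 (fun p : P k => nat_of_ord (p.1 x)) E.
have := congr1 (fun p : P k => nat_of_ord (p.2 x)) E.
rewrite !prism_cell1 !prism_cell2.
by case: (leqP (c x) j); case: (leqP (c' x) j) => /= *; lia.
Qed.

(** Of the faces opposite j and j + 1, the one opposite j + e is new; the other lies in the given
    end for the first cell and in the preceding cell afterwards. All remaining faces lie over the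
    boundary of the base. *)
Definition prism_horn : 'I_n.+2 := inord (j + e).

Let hE : prism_horn = j + e :> nat.
Proof. by rewrite /prism_horn inordK //; case: (e); lia. Qed.

Lemma prism_cell_in k c : prism s.+1 k (prism_cell k c).
Proof.
right; exists s; first by split.
move=> y; rewrite prism_cell1 prism_cell2.
by rewrite -/j; case: (leqP (c y) j) => /= *; lia.
Qed.

Lemma prism_horn_in k (c : mono k n.+1) :
  in_horn prism_horn c -> prism s k (prism_cell k c).
Proof.
case/existsP => i /andP[ik ic]; have {}ic x : nat_of_ord (c x) <> i.
  by move=> /val_inj E; case/codomP: ic; exists x.
have {}ik : nat_of_ord i <> j + e by rewrite -hE => /val_inj E; rewrite E eqxx in ik.
have ile := ltn_ord i.
have miss (q : 'I_n.+1) : (forall x, nat_of_ord ((prism_cell k c).1 x) <> q) ->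
    prism s k (prism_cell k c).
  by move=> H; left; left => /(_ q) [x xE]; case: (H x); rewrite xE.
have cst : (forall x, nat_of_ord ((prism_cell k c).2 x) = e) ->
    prism s k (prism_cell k c).
  move=> H; left; right; apply: mono_ext => x; apply: val_inj.
  by rewrite /= H mono_constE vxE.
have inp q : q < s -> in_prism (prism_idx q) (prism_cell k c) ->
    prism s k (prism_cell k c).
  by move=> qs H; right; exists q => //; split=> //; lia.
case: (ltnP i j) => [ij|ji].
  apply: (miss (inord i)) => x; rewrite prism_cell1 inordK; last by lia.
  by have := ic x; case: (leqP (c x) j) => /= *; lia.
case: (ltnP j.+1 i) => [ij'|ji'].
  apply: (miss (inord i.-1)) => x; rewrite prism_cell1 inordK; last by lia.
  by have := ic x; case: (leqP (c x) j) => /= *; lia.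
case: (posnP s) => s0.
  apply: cst => x; rewrite prism_cell2; have := ic x; have := ltn_ord (c x).
  move: ik ji ji' jn; rewrite /j /prism_idx s0; case: (e) => /=; case: (ltnP _ (c x)) => /= *; lia.
apply: (inp s.-1); first by lia.
move=> y; rewrite prism_cell1 prism_cell2; have := ic y.
by move: ik ji ji' jn; rewrite /j /prism_idx; case: (e); case: (leqP (c y) _) => /= *; lia.
Qed.

(** A simplex hitting every vertex other than j + e covers the whole base, and its vertex j + (1 -
    e) lies neither at the end e nor in any earlier cell. *)
Lemma prism_in_horn k (c : mono k n.+1) :
  prism s k (prism_cell k c) -> in_horn prism_horn c.
Proof.
move=> H; apply: contrapT => N.
have hit i : i <= n.+1 -> i <> j + e -> exists x, c x = i :> nat.
  move=> il ij; apply: contrapT => M; apply: N; apply/existsP; exists (inord i).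
  apply/andP; split.
    by apply/eqP => /(congr1 val); rewrite /= hE inordK.
  apply/codomP => -[x xE]; apply: M; exists x.
  by rewrite -xE inordK.
case: H => [[H|H]|[i [si _] H]].
- apply: H => q; have ql := ltn_ord q.
  case: (hit (if q < j + e then nat_of_ord q else q.+1)).
  + by case: (ltnP q (j + e)) => *; lia.
  + by case: (ltnP q (j + e)) => *; lia.
  + move=> x xE; exists x; apply: val_inj; rewrite /= prism_cell1 xE.
    by move: jn; case: (ltnP q (j + e)) => [|]; case: (leqP _ j) => /= *; lia.
- case: (hit (j + ~~ e)) => [||x xE].
  + by case: (e); lia.
  + by case: (e); lia.
  + have := prism_cell2 c x; rewrite H mono_constE vxE xE.
    by case: (e); lia.
- case: (hit (j + ~~ e)) => [||x xE].
  + by case: (e); lia.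
  + by case: (e); lia.
  + have := H x; rewrite prism_cell1 prism_cell2 xE.
    move: si jn; rewrite /j /prism_idx; case: (e) => /=.
      by rewrite addn0 ltnn leqnn => si _ [/(_ isT) H0 _]; lia.
    by rewrite addn1 ltnn ltnS leqnn /= => si _ [_ /(_ isT)]; lia.
Qed.

Definition horn_incl m (k : 'I_m.+1) : smap (horn k) (stdsimplex m) :=
  @SMap (horn k) (stdsimplex m) (fun _ x => val x) (fun _ _ _ _ => erefl).

Lemma prism_po : is_po (horn_incl prism_horn)
  (@corestr _ (prism s) (horn prism_horn) (smap_comp prism_cell (horn_incl prism_horn))
    (fun k x => prism_horn_in (valP x)))
  (incl_le (@prism_le s))
  (@corestr _ (prism s.+1) _ prism_cell prism_cell_in).
Proof.
split.
- by move=> k x; apply: sval_inj.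
- exact: incl_le_inj.
- move=> k [x Hx]; case: (Hx) => [Bx|[i [si ii] H]].
    by left; exists (exist _ x (or_introl Bx)); apply: sval_inj.
  case: (eqVneq i s) => [e'|ne]; last first.
    have Hx' : prism s k x by right; exists i => //; lia.
    by left; exists (exist _ x Hx'); apply: sval_inj.
  subst i; right.
  (* On its image, the inverse of [prism_cell] sends a vertex (a, t) to a + t. *)
  have cP (y z : 'I_k.+1) : y <= z -> (inord (x.1 y + x.2 y) : 'I_n.+2) <=
      (inord (x.1 z + x.2 z) : 'I_n.+2).
    move=> yz; have := mono_leq x.1 yz; have := mono_leq x.2 yz.
    have := ltn_ord (x.1 y); have := ltn_ord (x.2 y).
    have := ltn_ord (x.1 z); have := ltn_ord (x.2 z).
    by move=> *; rewrite !inordK; lia.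
  exists (mk_mono cP); apply: sval_inj => /=; case: x {Hx} H cP => a t H cP.
  have qE y : nat_of_ord (mk_mono cP y) = a y + t y.
    rewrite mk_monoE inordK //=.
    by have := ltn_ord (a y); have := ltn_ord (t y); lia.
  congr (_, _); apply: mono_ext => y; apply: ord_inj; have [H0 H1] := H y.
  + apply: etrans (esym (prism_cell1 (mk_mono cP) y)); rewrite qE /=.
    have := ltn_ord (t y); case: (nat_of_ord (t y)) H0 H1 => [|[|//]] H0 H1 _.
      by rewrite addn0 H0.
    by rewrite addn1 ltnNge H1.
  + apply: etrans (esym (prism_cell2 (mk_mono cP) y)); rewrite qE /=.
    have := ltn_ord (t y); case: (nat_of_ord (t y)) H0 H1 => [|[|//]] H0 H1 _.
      by rewrite addn0 ltnNge H0.
    by rewrite addn1 ltnS H1.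
- move=> k q [u Hu] /(congr1 sval) /= E; subst u.
  by exists (exist _ q (prism_in_horn Hu)); apply: val_inj.
- by move=> k q q' /(congr1 sval) /prism_cell_inj; left.
Qed.

End Step.

Lemma prism_LLP K : Kan K -> LLP (incl (sbox (bd n) vert)) (sterm K).
Proof.
move=> KK.
have -> : sbox (bd n) vert = prism 0.
  by apply: sub_ext => k x; split=> [|[|[i []]]]; [left| |lia].
apply: (@LLP_seq _ prism (@prism_le)) => [k x|s].
  exists n.+1; right; case: x => a t.
  (* The highest base vertex at level 0; the empty maximum gives j = 0 for a simplex lying entirely
     at level 1. *)
  pose j := \max_(y : 'I_k.+1 | t y == 0 :> nat) a y.
  have jn : j <= n by apply/bigmax_leqP => y _; rewrite -ltnS.
  exists (if e then j else n - j); first by case: e; lia.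
  rewrite (_ : prism_idx _ = j); last by rewrite /prism_idx; case: e; lia.
  move=> y; split=> /= [ty|/eqP ty]; first exact: (leq_bigmax_cond y).
  apply/bigmax_leqP => z /eqP tz; apply: mono_leq.
  by rewrite leqNgt; apply/negP => /ltnW /(mono_leq t); rewrite ty tz.
case: (leqP s n) => sn; last first.
  apply: LLP_bij => [|k [x Hx]]; first exact: incl_le_inj.
  have Hx' : prism s k x.
    by case: (Hx) => [|[i [si ii] H]]; [left|right; exists i => //; lia].
  by exists (exist _ x Hx'); apply: sval_inj.
apply: (LLP_po (prism_po sn)); apply/LLP_sterm => u.
exact: KK.
Qed.

End Prism.

(** * Homotopy extension *)

(** Its diagonal is B and its rows are discrete, so the one-directional skeleta of the diagonal
    become the ordinary skeleta of B. *)
Definition bconst (B : sset) : bisset :=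
  @BiSSet (fun m _ => B m) (fun _ _ _ _ a _ x => act a x)
    (fun m _ x => act_id x) (fun _ _ _ _ _ _ a' a _ _ x => act_comp a' a x).

Lemma bimg_act A B (i : smap A B) m m' n n' (a : mono m m') (b : mono n n')
    (x : bconst B m' n') :
  (exists y, x = i m' y) -> exists y, @bact (bconst B) _ _ _ _ a b x = i m y.
Proof. by case=> y ->; exists (act a y); rewrite smap_nat. Qed.

Definition bimg A B (i : smap A B) : bsub (bconst B) :=
  @BSub (bconst B) (fun m _ x => exists y, x = i m y) (@bimg_act A B i).

(** Rows being discrete, the lift is built separately for each x in B_m: on a latched x it is
    prescribed on all of Delta^m, otherwise only on the boundary. Independence of S from n makes
    this dichotomy depend on x alone. *)
Lemma LLP_bconst_cell B (S : bsub (bconst B)) m E F (p : smap E F) :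
  (forall n n' x, S m n x -> S m n' x) ->
  LLP (incl (bd m)) p -> LLP (incl (sbox (latch S m m) (bd m))) p.
Proof.
move=> Sc L u v uv; pose P := sbox (latch S m m) (bd m).
have Lc n n' (x : B m) : latch S m m n x -> latch S m m n' x.
  by case=> [/Sc Sx|[q qm xE]]; [left|right; exists q].
have cellP (x : B m) : exists w : smap (stdsimplex m) E,
    (forall n a (H : P n (x, a)), w n a = u n (exist _ (x, a) H)) /\
    (forall n a, p n (w n a) = v n (x, a)).
  have vnat k n (a : mono k n) (b : stdsimplex m n) :
      v k (x, act a b) = act a (v n (x, b)).
    by rewrite -smap_nat /= /sprod_act /= act_id.
  case: (pselect (latch S m m m x)) => lx.
    have H n a : P n (x, a) by left; apply: Lc lx.
    have wnat k n (a : mono k n) (b : stdsimplex m n) :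
        u k (exist _ (x, act a b) (H k (act a b))) = act a (u n (exist _ (x, b) (H n b))).
      rewrite -smap_nat; congr (u k _); apply: sval_inj => /=.
      by rewrite /sprod_act /= act_id.
    exists (SMap wnat); split=> [n a Ha|n a] /=; last by rewrite uv.
    by congr (u n _); apply: sval_inj.
  have H n (a : ssub (bd m) n) : P n (x, sval a) by right; case: a.
  have wnat k n (a : mono k n) (b : ssub (bd m) n) :
      u k (exist _ (x, sval (act a b)) (H k (act a b))) =
      act a (u n (exist _ (x, sval b) (H n b))).
    rewrite -smap_nat; congr (u k _); apply: sval_inj => /=.
    by rewrite /sprod_act /= act_id.
  have [|w [w1 w2]] := L (SMap wnat) (SMap vnat); first by move=> n a; rewrite /= uv.
  exists w; split=> // n a Ha; case: (Ha) => [/Lc/lx//|/= aB].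
  apply: etrans (w1 n (exist _ a aB)) _ => /=.
  by congr (u n _); apply: sval_inj.
pose W x := sval (cid (cellP x)).
have W1 x n a (H : P n (x, a)) : W x n a = u n (exist _ (x, a) H).
  by rewrite /W; case: cid => w [].
have W2 x n a : p n (W x n a) = v n (x, a) by rewrite /W; case: cid => w [].
have wnat k n (a : mono k n) (x : sprod (row (bconst B) m) (stdsimplex m) n) :
    W (act a x).1 k (act a x).2 = act a (W x.1 n x.2).
  by rewrite /= act_id -smap_nat.
by exists (SMap wnat); split=> [n [[x a] H]|n [x a]] /=.
Qed.

(** Skeletal induction relative to the image of i. *)
Lemma LLP_mono A B (i : smap A B) E F (p : smap E F) :
  sinj i -> (forall n, LLP (incl (bd n)) p) -> LLP i p.
Proof.
move=> iI L u v uv.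
have LD : LLP (incl (diag_sub (bimg i))) p.
  by apply: LLP_diag => m; apply: LLP_bconst_cell.
have [u' u'P] : exists u' : smap (ssub (diag_sub (bimg i))) E,
    forall n x, exists2 y, sval x = i n y & u' n x = u n y.
  apply: (@smap_of_rel (ssub (diag_sub (bimg i))) E
    (fun n x z => exists2 y, sval x = i n y & z = u n y)).
  - by move=> n [x [y xE]]; exists (u n y), y.
  - by move=> n x z z' [y E1 ->] [y' E2 ->]; rewrite (iI n y y') // -E1.
  - move=> m n a x z [y E1 ->]; exists (act a y); last by rewrite smap_nat.
    by rewrite smap_nat -E1.
pose v' := @SMap (diag (bconst B)) F v (@smap_nat _ _ v).
have [n x|w [w1 w2]] := LD u' v'.
  by case: (u'P n x) => y E1 ->; rewrite uv /= E1.
pose w' := @SMap B E w (@smap_nat _ _ w).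
exists w'; split=> // n x.
have ix : diag_sub (bimg i) n (i n x) by exists x.
have := w1 n (exist _ (i n x) ix) => /= ->.
by case: (u'P n (exist _ (i n x) ix)) => y /iI <- ->.
Qed.

(** By adjunction this is extension to the prism from its end e and its sides, that is
    [prism_LLP]. *)
Lemma LLP_bd_ev K : Kan K -> forall n e, LLP (incl (bd n)) (sev_at K e).
Proof.
move=> KK n e u v uv.
have [w wP] : exists w : smap (ssub (sbox (bd n) (vert e))) K, forall k x,
   (exists H : bd n k (sval x).1,
      w k x = uncurry u k (exist _ (sval x).1 H, (sval x).2)) \/
   (vert e k (sval x).2 /\ w k x = v k (sval x).1).
  apply: (@smap_of_rel (ssub (sbox (bd n) (vert e))) K (fun k x y =>
   (exists H : bd n k (sval x).1, y = uncurry u k (exist _ (sval x).1 H, (sval x).2)) \/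
   (vert e k (sval x).2 /\ y = v k (sval x).1))).
  - move=> k [[a t] [aB|te]].
      by exists (uncurry u k (exist _ a aB, t)); left; exists aB.
    by exists (v k a); right.
  - have Q k (a : stdsimplex n k) (t : I1 k) (aB : bd n k a) : vert e k t ->
        uncurry u k (exist _ a aB, t) = v k a.
      by move=> ->; rewrite -[RHS](uv k (exist _ a aB)).
    move=> k [[a t] H] y y' /= [[H1 ->]|[H1 ->]] [[H2 ->]|[H2 ->]] //.
    + by congr (uncurry u k (_, t)); apply: sval_inj.
    + exact: Q.
    + exact: (esym (Q _ _ _ _ _)).
  - move=> k l b [[a t] H] y [[H1 ->]|[H1 ->]].
      left; exists (sub_act b H1); rewrite -smap_nat; congr (uncurry u k (_, _)).
      exact: sval_inj.
    by right; split; [apply: (sub_act b H1)|rewrite smap_nat].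
have /LLP_sterm /(_ w) [f f1] := prism_LLP (n := n) (e := e) KK.
exists (curry f); split.
  suff E : smap_comp (curry f) (incl (bd n)) = u by move=> k x; rewrite -E.
  apply: sexp_ext => k x t.
  have H : sbox (bd n) (vert e) k (sval x, t) by left; case: (x).
  have := f1 k (exist _ (sval x, t) H).
  rewrite -(curryK f) /= => ->.
  case: (wP k (exist _ (sval x, t) H)) => /= [[H' ->]|[te ->]].
    by congr (uncurry u k (_, t)); apply: sval_inj.
  by move: te => /= ->; rewrite -[LHS](uv k x).
move=> k a; have H : sbox (bd n) (vert e) k (a, mono_const k (vx e)) by right.
have := f1 k (exist _ (a, mono_const k (vx e)) H).
rewrite -(curryK f) /= => ->.
case: (wP k (exist _ (a, mono_const k (vx e)) H)) => /= [[H' ->]|[te ->]] //.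
by rewrite -[RHS](uv k (exist _ a H')).
Qed.

Lemma HEP K (e : bool) A B (i : smap A B) (h : smap (sprod A I1) K) (v : smap B K) :
  Kan K -> sinj i -> (forall n x, h n (x, mono_const n (vx e)) = v n (i n x)) ->
  exists H : smap (sprod B I1) K, (forall n x t, H n (i n x, t) = h n (x, t)) /\
    (forall n y, H n (y, mono_const n (vx e)) = v n y).
Proof.
move=> KK iI hv.
have L : LLP i (sev_at K e) by apply: (LLP_mono iI) => n; apply: LLP_bd_ev.
have [|w [w1 w2]] := L (curry h) v.
  by move=> n x; rewrite -hv -[RHS](curryK h).
exists (uncurry w); split=> [n x t|n y]; last exact: w2.
by rewrite -(curryK h) /= w1.
Qed.

(** * Exponentials of Kan complexes *)

Section KanExp.
Variables (n : nat) (k : 'I_n.+2).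
Let e : bool := k == n.+1 :> nat.

(** This is min(q, k) when k is not the last vertex, and constantly k when it is; a vertex other
    than k is missed in both cases. It moves vertices down or up respectively, which dictates the
    end e of the interval at which it is applied. *)
Definition clip (q : 'I_n.+2) : 'I_n.+2 :=
  if e then (if q <= k then k else q) else (if q <= k then q else k).

Lemma clip_leq (x y : 'I_n.+2) : x <= y -> clip x <= clip y.
Proof.
rewrite /clip; case: e; case: (leqP x k); case: (leqP y k) => //=; lia.
Qed.

Lemma clip_end (x : 'I_n.+2) : if e then x <= clip x else clip x <= x.
Proof. by rewrite /clip; case: e; case: (leqP x k) => //=; lia. Qed.

Lemma clip_or q : clip q = q \/ clip q = k.
Proof. by rewrite /clip; case: e; case: leqP; [right|left|left|right]. Qed.

Lemma clip_miss : exists2 i, i != k & forall q, clip q != i.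
Proof.
rewrite /clip; case: (boolP e) => ek.
  exists ord0; first by apply/eqP => k0; move: ek; rewrite /e -k0.
  by move=> q; case: leqP => qk; apply/eqP => /(congr1 val) /=; move/eqP: ek; lia.
have kl : k < n.+1 by have := ltn_ord k; move/eqP: ek; lia.
exists ord_max; first by apply/eqP => /(congr1 val) /=; lia.
by move=> q; case: leqP => qk; apply/eqP => /(congr1 val) /=; lia.
Qed.

Lemma retr_leq m (x : mono m n.+1) (t : mono m 1) (y z : 'I_m.+1) : y <= z ->
  (if t y == vx e then clip (x y) else x y) <=
  (if t z == vx e then clip (x z) else x z).
Proof.
move=> yz; have xyz := mono_leq x yz; have tyz := mono_leq t yz.
have := clip_leq xyz; have := clip_end (x y); have := clip_end (x z).
have := ltn_ord (t y); have := ltn_ord (t z); rewrite -!val_eqE /= vxE.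
by case: e => /=; do 2 case: eqP; lia.
Qed.

Lemma retr_nat l m (a : mono l m) (p : sprod (stdsimplex n.+1) I1 m) :
  mk_mono (@retr_leq l (act a p).1 (act a p).2) =
  mono_comp (mk_mono (@retr_leq m p.1 p.2)) a.
Proof.
by apply: mono_ext => y; rewrite mono_compE !mk_monoE.
Qed.

(* Pushes the end e of the prism into the horn; at the other end it is the    *)
(* identity.                                                                  *)
Definition retr : smap (sprod (stdsimplex n.+1) I1) (stdsimplex n.+1) :=
  @SMap (sprod (stdsimplex n.+1) I1) (stdsimplex n.+1)
    (fun m p => mk_mono (@retr_leq m p.1 p.2)) retr_nat.

Lemma retrE m x t y : retr m (x, t) y = if t y == vx e then clip (x y) else x y.
Proof. by rewrite mk_monoE. Qed.

Lemma retr_other m x : retr m (x, mono_const m (vx (~~ e))) = x.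
Proof.
by apply: mono_ext => y; rewrite retrE mono_constE -val_eqE /= !vxE; case: e.
Qed.

Lemma retr_horn m x t : in_horn k x -> in_horn k (retr m (x, t)).
Proof.
case/existsP=> i /andP[ik ix]; apply/existsP; exists i; rewrite ik /=.
apply: contra ix => /codomP [y iE]; apply/codomP; exists y; rewrite iE retrE.
case: eqP => // te; case: (clip_or (x y)) => [->//|ck].
by move: ik; rewrite iE retrE te eqxx ck eqxx.
Qed.

Lemma retr_end m x : in_horn k (retr m (x, mono_const m (vx e))).
Proof.
have [i ik iM] := clip_miss; apply/existsP; exists i; rewrite ik /=.
apply/codomP => -[y iE]; have := iM (x y).
by rewrite iE !ffunE !eqxx.
Qed.

Definition hcorestr X (f : smap X (stdsimplex n.+1)) (fH : forall m x, in_horn k (f m x)) :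
    smap X (horn k).
refine (@SMap X (horn k) (fun m x => exist _ (f m x) (fH m x)) _).
by move=> l m a x; apply: val_inj; rewrite /= smap_nat.
Defined.

(** At the end e, [retr] lands in the horn, so u composed with it is defined on the whole simplex;
    along the horn it is defined at all times. Homotopy extension completes the prism, and the other
    end is the filler. *)
Lemma horn_sexp_fill D K (u : smap (horn k) (sexp D K)) : Kan K ->
  exists v : smap (stdsimplex n.+1) (sexp D K),
    forall m (x : horn k m), v m (val x) = u m x.
Proof.
move=> KK.
pose r1 := @hcorestr (sprod (horn k) I1)
  (smap_comp retr (sprod_map (horn_incl k) (smap_id I1)))
  (fun m x => @retr_horn m (val x.1) x.2 (valP x.1)).
pose r2 := @hcorestr (stdsimplex n.+1)
  (smap_comp retr (spair (smap_id _) (svtx _ (vx e)))) retr_end.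
pose pr : smap (sprod (sprod (horn k) D) I1) (sprod (horn k) I1) :=
  sprod_map (sfst _ _) (smap_id _).
pose h := smap_comp (uncurry u) (spair (smap_comp r1 pr)
  (smap_comp (ssnd _ _) (sfst (sprod (horn k) D) I1))).
pose v := smap_comp (uncurry u) (sprod_map r2 (smap_id D)).
have iI : sinj (sprod_map (horn_incl k) (smap_id D)).
  by apply: sprod_map_inj => m x y E //; apply: val_inj.
have [|H [H1 H2]] := @HEP K e _ _ _ h v KK iI.
  move=> m [x d]; congr (uncurry u m (_, d)); exact: val_inj.
pose G := smap_comp H (spair (smap_id _) (svtx _ (vx (~~ e)))).
exists (curry G).
suff E : smap_comp (curry G) (horn_incl k) = u by move=> m x; rewrite -E.
apply: sexp_ext => m x d; apply: etrans (curryK G (val x, d)) _.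
apply: etrans (H1 m (x, d) (mono_const m (vx (~~ e)))) _.
by congr (uncurry u m (_, d)); apply: val_inj; apply: retr_other.
Qed.

End KanExp.

Lemma Kan_sexp D K : Kan K -> Kan (sexp D K).
Proof. by move=> KK n k u; apply: horn_sexp_fill. Qed.

(** * Open boxes, and homotopy as an equivalence relation *)

Lemma vx_inj n : mono_const n (vx false) <> mono_const n (vx true).
Proof.
move=> /(congr1 (fun a : mono n 1 => nat_of_ord (a ord0))).
by rewrite !mono_constE !vxE.
Qed.

(* In the square with coordinates s (along H0) and t (along S0 and S1), three *)
(* sides are given over B and a full square over A; the fourth side is found. *)
Lemma rel_box K A B (i : smap A B) (H0 S0 S1 : smap (sprod B I1) K)
    (a : smap (sprod (sprod A I1) I1) K) :
  Kan K -> sinj i ->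
  (forall n y, S0 n (y, mono_const n (vx false)) = H0 n (y, mono_const n (vx false))) ->
  (forall n y, S1 n (y, mono_const n (vx false)) = H0 n (y, mono_const n (vx true))) ->
  (forall n x t, S0 n (i n x, t) = a n ((x, mono_const n (vx false)), t)) ->
  (forall n x t, S1 n (i n x, t) = a n ((x, mono_const n (vx true)), t)) ->
  (forall n x s, H0 n (i n x, s) = a n ((x, s), mono_const n (vx false))) ->
  exists H1 : smap (sprod B I1) K,
  [/\ forall n y, H1 n (y, mono_const n (vx false)) = S0 n (y, mono_const n (vx true)),
      forall n y, H1 n (y, mono_const n (vx true)) = S1 n (y, mono_const n (vx true)) &
      forall n x s, H1 n (i n x, s) = a n ((x, s), mono_const n (vx true))].
Proof.
move=> KK iI SH0 SH1 Sa0 Sa1 Ha.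
pose P n (p : sprod B I1 n) := (exists x, p.1 = i n x) \/
  p.2 = mono_const n (vx false) \/ p.2 = mono_const n (vx true).
have Pact m n (c : mono m n) p : P n p -> P m (act c p).
  case=> [[x E]|[E|E]]; [left; exists (act c x)|right; left|right; right];
  by rewrite /= E ?smap_nat ?mono_const_comp.
(* The box is filled by homotopy extension in the direction t, along the union of i(A) x I and B x
   {0, 1}. *)
pose U : sub (sprod B I1) := Sub Pact.
pose R n (p : sprod (ssub U) I1 n) z :=
  [\/ exists2 x, (sval p.1).1 = i n x & z = a n ((x, (sval p.1).2), p.2),
      (sval p.1).2 = mono_const n (vx false) /\ z = S0 n ((sval p.1).1, p.2) |
      (sval p.1).2 = mono_const n (vx true) /\ z = S1 n ((sval p.1).1, p.2)].
have Rfun n p z z' : R n p z -> R n p z' -> z = z'.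
  case: p => [[[y s] Hp] t]; case=> [[/= x E1 ->]|[/= E1 ->]|[/= E1 ->]];
    case=> [[/= x' E2 ->]|[/= E2 ->]|[/= E2 ->]]; try by [].
  - by rewrite (iI n x x') // -E1.
  - by rewrite E1 E2 Sa0.
  - by rewrite E1 E2 Sa1.
  - by rewrite E1 E2 Sa0.
  - by case: (@vx_inj n); rewrite -E1.
  - by rewrite E1 E2 Sa1.
  - by case: (@vx_inj n); rewrite -E2.
have [h hR] : exists h : smap (sprod (ssub U) I1) K, forall n p, R n p (h n p).
  apply: smap_of_rel => // [n [[[y s] /= Hp] t]|m n c [[[y s] /= Hp] t] z].
  - case: (Hp) => [[x xE]|[sE|sE]].
    + by exists (a n ((x, s), t)); apply: Or31; exists x.
    + by exists (S0 n (y, t)); apply: Or32.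
    + by exists (S1 n (y, t)); apply: Or33.
  - case=> [[/= x E1 ->]|[/= E1 ->]|[/= E1 ->]].
    + by apply: Or31; exists (act c x); rewrite /= ?E1 -smap_nat.
    + by apply: Or32; rewrite /= E1 mono_const_comp -smap_nat.
    + by apply: Or33; rewrite /= E1 mono_const_comp -smap_nat.
have hE n p z : R n p z -> h n p = z by apply: Rfun (hR n p).
have [|H [H1 H2]] := @HEP K false _ _ _ h H0 KK (@incl_inj _ U).
  move=> n [[y s] Hp]; apply: hE => /=.
  case: (Hp) => [[x /= xE]|[/= sE|/= sE]].
  - by apply: Or31; exists x => //=; rewrite xE Ha.
  - by apply: Or32; split=> //=; rewrite sE SH0.
  - by apply: Or33; split=> //=; rewrite sE SH1.
exists (smap_comp H (spair (smap_id _) (svtx _ (vx true)))); split=> n y /=.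
- have Hp : U n (y, mono_const n (vx false)) by right; left.
  have <- := hE n (exist _ _ Hp, mono_const n (vx true)) (S0 n (y, mono_const n (vx true))).
    exact: (H1 n (exist _ _ Hp)).
  exact: Or32.
- have Hp : U n (y, mono_const n (vx true)) by right; right.
  have <- := hE n (exist _ _ Hp, mono_const n (vx true)) (S1 n (y, mono_const n (vx true))).
    exact: (H1 n (exist _ _ Hp)).
  exact: Or33.
- move=> s; have Hp : U n (i n y, s) by left; exists y.
  have <- := hE n (exist _ _ Hp, mono_const n (vx true)) (a n ((y, s), mono_const n (vx true))).
    exact: (H1 n (exist _ _ Hp)).
  by apply: Or31; exists y.
Qed.

Lemma elem_refl X K (u : smap X K) : elem_homotopic u u.
Proof. by exists (smap_comp u (sfst X I1)). Qed.

(** The case of [rel_box] in which A is empty; symmetry and transitivity are boxes with constant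
    sides. *)
Lemma elem_box X K (u v u' v' : smap X K) : Kan K ->
  elem_homotopic u v -> elem_homotopic u u' -> elem_homotopic v v' ->
  elem_homotopic u' v'.
Proof.
move=> KK [H0 H0E] [S0 S0E] [S1 S1E].
pose emp := @SMap (sdisc Empty_set) X (fun _ x => match x with end)
  (fun _ _ _ x => match x with end).
have [||||||H [E0 E1 _]] := @rel_box K _ _ emp H0 S0 S1
  (@SMap (sprod (sprod (sdisc Empty_set) I1) I1) K
    (fun _ x => match x.1.1 with end) (fun _ _ _ x => match x.1.1 with end)) KK.
- by move=> n [].
- by move=> n y; have [-> _] := S0E n y; have [-> _] := H0E n y.
- by move=> n y; have [-> _] := S1E n y; have [_ ->] := H0E n y.
- by move=> n [].
- by move=> n [].
- by move=> n [].
exists H => n x; split.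
  by have [_ <-] := S0E n x; apply: E0.
by have [_ <-] := S1E n x; apply: E1.
Qed.

Lemma elem_sym X K (u v : smap X K) : Kan K ->
  elem_homotopic u v -> elem_homotopic v u.
Proof. by move=> KK uv; apply: (elem_box KK (elem_refl u) uv (elem_refl u)). Qed.

Lemma elem_trans X K (u v w : smap X K) : Kan K ->
  elem_homotopic u v -> elem_homotopic v w -> elem_homotopic u w.
Proof. by move=> KK uv vw; apply: (elem_box KK uv (elem_refl u) vw). Qed.

Lemma homotopicE X K (u v : smap X K) : Kan K ->
  homotopic u v <-> elem_homotopic u v.
Proof.
move=> KK; split; last exact: rst_step.
elim=> // {u v} [u|u v _|u v w _ uv _]; [exact: elem_refl|exact: elem_sym|].
exact: elem_trans.
Qed.

Lemma elem_postcomp X K L (k : smap K L) (u v : smap X K) :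
  elem_homotopic u v -> elem_homotopic (smap_comp k u) (smap_comp k v).
Proof. by case=> H HE; exists (smap_comp k H) => n x; have /= [-> ->] := HE n x. Qed.

Lemma elem_precomp X Y K (f : smap X Y) (u v : smap Y K) :
  elem_homotopic u v -> elem_homotopic (smap_comp u f) (smap_comp v f).
Proof.
by case=> H HE; exists (smap_comp H (sprod_map f (smap_id I1))) => n x; apply: HE.
Qed.

Lemma homotopic_map X K X' K' (F : smap X K -> smap X' K') (u v : smap X K) :
  (forall u v, elem_homotopic u v -> elem_homotopic (F u) (F v)) ->
  homotopic u v -> homotopic (F u) (F v).
Proof.
move=> HF; elim=> {u v} [u v /HF|u|u v _|u v w _ uv _].
- exact: rst_step.
- exact: rst_refl.
- exact: rst_sym.
- exact: rst_trans.
Qed.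

Lemma homotopic_postcomp X K L (k : smap K L) (u v : smap X K) :
  homotopic u v -> homotopic (smap_comp k u) (smap_comp k v).
Proof. by apply: homotopic_map => *; apply: elem_postcomp. Qed.

Lemma homotopic_precomp X Y K (f : smap X Y) (u v : smap Y K) :
  homotopic u v -> homotopic (smap_comp u f) (smap_comp v f).
Proof. by apply: (homotopic_map (F := fun w => smap_comp w f)) => *; apply: elem_precomp. Qed.

Lemma smap_compA W X Y Z (h : smap Y Z) (g : smap X Y) (f : smap W X) :
  smap_comp h (smap_comp g f) = smap_comp (smap_comp h g) f.
Proof. exact: smap_ext. Qed.

Lemma smap_comp1 X Y (f : smap X Y) : smap_comp f (smap_id X) = f.
Proof. exact: smap_ext. Qed.

(** * Weak equivalences *)

Lemma weqP X Y (f : smap X Y) : weak_equiv f <->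
  forall K, Kan K ->
    (forall v w : smap Y K, elem_homotopic (smap_comp v f) (smap_comp w f) ->
       elem_homotopic v w) /\
    (forall u : smap X K, exists v : smap Y K, elem_homotopic (smap_comp v f) u).
Proof.
split=> H K KK; have [inj sur] := H K KK; split=> [v w|u].
- by move=> vw; apply/(homotopicE _ _ KK); apply: inj; apply/(homotopicE _ _ KK).
- by have [v vu] := sur u; exists v; apply/(homotopicE _ _ KK).
- by move=> vw; apply/(homotopicE _ _ KK); apply: inj; apply/(homotopicE _ _ KK).
- by have [v vu] := sur u; exists v; apply/(homotopicE _ _ KK).
Qed.

Lemma weq_comp X Y Z (g : smap Y Z) (f : smap X Y) :
  weak_equiv f -> weak_equiv g -> weak_equiv (smap_comp g f).
Proof.
move=> fW gW K KK; have [fi fs] := fW K KK; have [gi gs] := gW K KK; split=> [v w|u].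
  by rewrite !smap_compA => /fi /gi.
have [v vu] := fs u; have [w wv] := gs v; exists w; rewrite smap_compA.
by apply: rst_trans vu; apply: homotopic_precomp.
Qed.

Lemma weq_cancel_l X Y Z (g : smap Y Z) (f : smap X Y) :
  weak_equiv f -> weak_equiv (smap_comp g f) -> weak_equiv g.
Proof.
move=> fW gW K KK; have [fi fs] := fW K KK; have [gi gs] := gW K KK; split=> [v w H|u].
  by apply: gi; rewrite !smap_compA; apply: homotopic_precomp.
have [w wv] := gs (smap_comp u f); exists w; apply: fi.
by rewrite -smap_compA.
Qed.

Lemma weq_cancel_r X Y Z (g : smap Y Z) (f : smap X Y) :
  weak_equiv g -> weak_equiv (smap_comp g f) -> weak_equiv f.
Proof.
move=> gW fW K KK; have [fi fs] := fW K KK; have [gi gs] := gW K KK; split=> [v w H|u].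
  have [v' vv'] := gs v; have [w' ww'] := gs w.
  apply: rst_trans (ww'); apply: rst_trans (rst_sym _ _ _ _ vv') _.
  apply: homotopic_precomp; apply: fi; rewrite !smap_compA.
  apply: rst_trans (homotopic_precomp f vv') _; apply: rst_trans H _.
  by apply/rst_sym/homotopic_precomp.
by have [w wv] := fs u; exists (smap_comp w g); rewrite -smap_compA.
Qed.

Lemma weq_hequiv X Y (f : smap X Y) (g : smap Y X) :
  homotopic (smap_comp g f) (smap_id X) -> homotopic (smap_comp f g) (smap_id Y) ->
  weak_equiv f.
Proof.
move=> gf fg K KK; split=> [v w H|u].
  rewrite -(smap_comp1 v) -(smap_comp1 w).
  apply: rst_trans (rst_sym _ _ _ _ (homotopic_postcomp v fg)) _.
  apply: rst_trans (homotopic_postcomp w fg).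
  by rewrite !smap_compA; apply: homotopic_precomp.
exists (smap_comp u g); rewrite -smap_compA -[u in X in homotopic _ X]smap_comp1.
exact: homotopic_postcomp.
Qed.

Lemma weq_iso X Y (f : smap X Y) (g : smap Y X) :
  (forall n x, g n (f n x) = x) -> (forall n y, f n (g n y) = y) -> weak_equiv f.
Proof.
move=> gf fg; apply: (@weq_hequiv _ _ f g).
  by rewrite (_ : smap_comp g f = smap_id X); [apply: rst_refl|apply: smap_ext].
by rewrite (_ : smap_comp f g = smap_id Y); [apply: rst_refl|apply: smap_ext].
Qed.

Definition sswap X Y : smap (sprod X Y) (sprod Y X) := spair (ssnd X Y) (sfst X Y).

Definition sswap_r X Y Z : smap (sprod (sprod X Y) Z) (sprod (sprod X Z) Y) :=
  spair (sprod_map (sfst X Y) (smap_id Z)) (smap_comp (ssnd X Y) (sfst _ Z)).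

Lemma elem_uncurry X D K (u v : smap X (sexp D K)) :
  elem_homotopic u v -> elem_homotopic (uncurry u) (uncurry v).
Proof.
case=> H HE; exists (smap_comp (uncurry H) (sswap_r X D I1)) => n [x d].
by have /= [-> ->] := HE n x.
Qed.

Lemma elem_curry X D K (u v : smap (sprod X D) K) :
  elem_homotopic u v -> elem_homotopic (curry u) (curry v).
Proof.
case=> H HE; pose G := curry (smap_comp H (sswap_r X I1 D)); exists G.
have GE (e : 'I_2) (w : smap (sprod X D) K) :
    (forall n x, H n (x, mono_const n e) = w n x) ->
    forall n x, G n (x, mono_const n e) = curry w n x.
  move=> E; suff <- : smap_comp G (spair (smap_id X) (svtx X e)) = curry w by [].
  apply: sexp_ext => n x d; apply: etrans (curryK (smap_comp H (sswap_r X I1 D)) ((x, mono_const n e), d)) _.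
  by rewrite curryK; apply: E.
by split; apply: GE => m [y d]; case: (HE m (y, d)).
Qed.

Lemma uncurry_curry X D K (u : smap (sprod X D) K) : uncurry (curry u) = u.
Proof. by apply: smap_ext => n p; rewrite curryK. Qed.

Lemma curry_precomp X Y D K (f : smap X Y) (u : smap (sprod Y D) K) :
  curry (smap_comp u (sprod_map f (smap_id D))) = smap_comp (curry u) f.
Proof.
apply: sexp_ext => n x d; rewrite curryK.
exact: esym (curryK u (f n x, d)).
Qed.

(** Maps Y x D -> K and their homotopies correspond to maps Y -> K^D and theirs, and K^D is again
    Kan. *)
Lemma weq_prod X Y D (f : smap X Y) :
  weak_equiv f -> weak_equiv (sprod_map f (smap_id D)).
Proof.
move=> /weqP fW; apply/weqP => K KK; have [fi fs] := fW _ (@Kan_sexp D K KK).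
split=> [v w /elem_curry|u].
  rewrite !curry_precomp => /fi /elem_uncurry.
  by rewrite !uncurry_curry.
have [v /elem_uncurry vu] := fs (curry u); exists (uncurry v).
by rewrite -[u]uncurry_curry (_ : smap_comp _ _ = uncurry (smap_comp v f)) //; apply: smap_ext.
Qed.

(** * Acyclic cofibrations *)

Definition acof A B (i : smap A B) := sinj i /\ weak_equiv i.

(** Surjectivity on homotopy classes gives an extension up to homotopy, which homotopy extension
    makes strict. *)
Lemma acof_ext A B (i : smap A B) K (u : smap A K) : acof i -> Kan K ->
  exists v : smap B K, forall n x, v n (i n x) = u n x.
Proof.
move=> [iI /weqP iW] KK; have [_ /(_ u) [v [H HE]]] := iW K KK.
have [|G [G1 G2]] := @HEP K false _ _ i H v KK iI.
  by move=> n x; have [-> _] := HE n x.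
exists (smap_comp G (spair (smap_id _) (svtx _ (vx true)))) => n x /=.
by rewrite G1; have [_ ->] := HE n x.
Qed.

(* Since A -> B stays acyclic after taking the product with F = K^A, there is *)
(* a section s of the restriction K^B -> K^A; it is a homotopy inverse, and   *)
(* the homotopy can be made vertical. This is the usual proof that a          *)
(* fibration which is a homotopy equivalence has the relative lifting         *)
(* property.                                                                  *)
Section HomotopyExtension.
Variables (A B K : sset) (i : smap A B).
Hypotheses (iA : acof i) (KK : Kan K).
Variable s : smap (sprod B (sexp A K)) K.
Hypothesis sP : forall n x (p : sexp A K n), s n (i n x, p) = sev A K n (p, x).

Let ext (h : smap (sprod A I1) K) : smap (sprod B I1) K :=
  smap_comp s (sprod_map (smap_id B) (curry (smap_comp h (sswap I1 A)))).

Let ext0 (u : smap A K) : smap B K :=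
  smap_comp s (spair (smap_id B) (curry (smap_comp u (ssnd B A)))).

Let extE h n x t : ext h n (i n x, t) = h n (x, t).
Proof. by rewrite /= sP; apply: (curryK (smap_comp h (sswap I1 A)) (t, x)). Qed.

Let ext0E u n x : ext0 u n (i n x) = u n x.
Proof. by rewrite /= sP; apply: (curryK (smap_comp u (ssnd B A)) (i n x, x)). Qed.

Let ext_end (h : smap (sprod A I1) K) (u : smap A K) e n (y : B n) : (forall n x, h n (x, mono_const n (vx e)) = u n x) ->
  ext h n (y, mono_const n (vx e)) = ext0 u n y.
Proof.
move=> hu; congr (s n (y, _)); apply: smap_ext => k [a x] /=.
by rewrite mono_const_comp hu.
Qed.

Let vertical (v : smap B K) : exists V : smap (sprod B I1) K,
  [/\ forall n y, V n (y, mono_const n (vx false)) = ext0 (smap_comp v i) n y,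
      forall n y, V n (y, mono_const n (vx true)) = v n y &
      forall n x t, V n (i n x, t) = v n (i n x)].
Proof.
have [iI /weqP iW] := iA; have [inj _] := iW K KK.
have [G GE] : elem_homotopic (ext0 (smap_comp v i)) v.
  apply: inj; rewrite (_ : smap_comp (ext0 _) i = smap_comp v i).
    exact: elem_refl.
  by apply: smap_ext => n x; apply: ext0E.
have G0 n y : G n (y, mono_const n (vx false)) = ext0 (smap_comp v i) n y.
  by case: (GE n y).
have G1 n y : G n (y, mono_const n (vx true)) = v n y by case: (GE n y).
pose g := smap_comp G (sprod_map i (smap_id I1)).
have g0 n x : g n (x, mono_const n (vx false)) = smap_comp v i n x.
  by apply: etrans (G0 n (i n x)) _; apply: ext0E.
have g1 n x : g n (x, mono_const n (vx true)) = smap_comp v i n x.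
  exact: G1.
(* The homotopy G need not be constant over A, where it traces a loop g. The box with sides [ext g]
   and G cancels this loop. *)
have [|||||H [H1 H2 H3]] := @rel_box K A B i (smap_comp (ext0 (smap_comp v i)) (sfst B I1))
  (ext g) G (smap_comp g (sprod_map (sfst A I1) (smap_id I1))) KK iI.
- by move=> n y; apply: ext_end.
- by move=> n y; apply: G0.
- by move=> n x t; apply: extE.
- by [].
- by move=> n x t; apply: etrans (ext0E _ _) _; apply: esym (g0 n x).
exists H; split=> [n y|n y|n x t].
- by rewrite H1; apply: ext_end.
- by rewrite H2.
- by rewrite H3; apply: g1.
Qed.

(** [ext h] extends h but has the wrong ends; the vertical homotopies carry these to v0 and v1
    without changing anything over A. *)
Lemma acof_hext_section (h : smap (sprod A I1) K) (v0 v1 : smap B K) :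
  (forall n x, h n (x, mono_const n (vx false)) = v0 n (i n x)) ->
  (forall n x, h n (x, mono_const n (vx true)) = v1 n (i n x)) ->
  exists H : smap (sprod B I1) K,
  [/\ forall n y, H n (y, mono_const n (vx false)) = v0 n y,
      forall n y, H n (y, mono_const n (vx true)) = v1 n y &
      forall n x t, H n (i n x, t) = h n (x, t)].
Proof.
move=> hv0 hv1; have [iI _] := iA.
have [V0 [V00 V01 V0i]] := vertical v0; have [V1 [V10 V11 V1i]] := vertical v1.
have [|||||H [H1 H2 H3]] := @rel_box K A B i (ext h) V0 V1
  (smap_comp h (sfst _ I1)) KK iI.
- by move=> n y; rewrite V00; apply/esym/ext_end.
- by move=> n y; rewrite V10; apply/esym/ext_end.
- by move=> n x t; rewrite V0i; apply: esym (hv0 n x).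
- by move=> n x t; rewrite V1i; apply: esym (hv1 n x).
- by move=> n x t; apply: extE.
exists H; split=> [n y|n y|n x t].
- by rewrite H1.
- by rewrite H2.
- by rewrite H3.
Qed.

End HomotopyExtension.

Lemma acof_prod A B D (i : smap A B) : acof i -> acof (sprod_map i (smap_id D)).
Proof.
by case=> iI iW; split; [apply: sprod_map_inj => // n x y|apply: weq_prod].
Qed.

Lemma acof_hext A B (i : smap A B) K (h : smap (sprod A I1) K) (v0 v1 : smap B K) :
  acof i -> Kan K ->
  (forall n x, h n (x, mono_const n (vx false)) = v0 n (i n x)) ->
  (forall n x, h n (x, mono_const n (vx true)) = v1 n (i n x)) ->
  exists H : smap (sprod B I1) K,
  [/\ forall n y, H n (y, mono_const n (vx false)) = v0 n y,
      forall n y, H n (y, mono_const n (vx true)) = v1 n y &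
      forall n x t, H n (i n x, t) = h n (x, t)].
Proof.
(* The section s extends the evaluation A x K^A -> K to B x K^A. *)
move=> iA KK; have [s sP] := acof_ext
  (smap_comp (sev A K) (sswap A (sexp A K))) (acof_prod (sexp A K) iA) KK.
by apply: (acof_hext_section iA KK (s := s)) => n x p; apply: (sP n (x, p)).
Qed.

(** The two lifting properties are strict forms of surjectivity and injectivity on homotopy classes
    of maps into K, made strict by [acof_ext] and [acof_hext]. *)
Lemma acofP A B (i : smap A B) : acof i <->
  sinj i /\ forall K, Kan K -> LLP i (sterm K) /\ LLP i (sev_ends K).
Proof.
split=> [iA|[iI iL]].
  case: (iA) => iI _; split=> // K KK; split.
    by apply/LLP_sterm => u; apply: acof_ext.
  move=> u v uv.
  have [||H [H0 H1 Hi]] := @acof_hext A B i K (uncurry u)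
    (smap_comp (sfst K K) v) (smap_comp (ssnd K K) v) iA KK.
  - by move=> n x; rewrite /= -uv.
  - by move=> n x; rewrite /= -uv.
  exists (curry H); split=> [n x|n y].
    suff E : smap_comp (curry H) i = u by rewrite -E.
    apply: sexp_ext => m z t; apply: etrans (curryK H (i m z, t)) _; exact: Hi.
  rewrite [v n y]surjective_pairing /=.
  congr (_, _).
    by apply: etrans (curryK H (y, mono_const n (vx false))) (H0 n y).
  by apply: etrans (curryK H (y, mono_const n (vx true))) (H1 n y).
split=> //; apply/weqP => K KK; have [L1 L2] := iL K KK; split=> [v w [H HE]|u].
  have [|G [G1 G2]] := L2 (curry H) (spair v w).
    move=> n x; have [E0 E1] := HE n x; rewrite /=; congr (_, _).
      by apply: etrans (curryK H (x, mono_const n (vx false))) E0.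
    by apply: etrans (curryK H (x, mono_const n (vx true))) E1.
  by exists (uncurry G) => n x; case: (G2 n x).
move/LLP_sterm/(_ u): L1 => [v vu]; exists v.
by rewrite (_ : smap_comp v i = u); [apply: elem_refl|apply: smap_ext].
Qed.

Lemma acof_po P Q U V (i : smap P Q) a (j : smap U V) b :
  is_po i a j b -> acof i -> acof j.
Proof.
move=> po /acofP [iI iL]; apply/acofP; split; first exact: (po_inj po).
by move=> K /iL [L1 L2]; split; apply: (LLP_po po).
Qed.

(** U x D -> [sbox U V] is a pushout of the acyclic U x V -> B x V, and its composite with the
    inclusion into B x D is acyclic too; two out of three remains. *)
Lemma acof_box B D (U : sub B) (V : sub D) :
  acof (incl U) -> acof (incl (sbox U V)).
Proof.
move=> UA; split; first exact: incl_inj.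
pose jm : smap (sprod (ssub U) D) (sprod B D) := sprod_map (incl U) (smap_id D).
have jU n x : sbox U V n (jm n x) by left; case: x => [[]].
pose bm : smap (sprod B (ssub V)) (sprod B D) := sprod_map (smap_id B) (incl V).
have bU n x : sbox U V n (bm n x) by right; case: x => [y []].
have po : is_po (sprod_map (incl U) (smap_id (ssub V)))
    (sprod_map (smap_id (ssub U)) (incl V)) (corestr jU) (corestr bU).
  split.
  - by move=> n [x y]; apply: sval_inj.
  - move=> n [x y] [x' y'] /(congr1 sval) /= [/sval_inj -> ->] //.
  - move=> n [[x y] [Ux|Vy]]; [left|right].
      by exists (exist _ x Ux, y); apply: sval_inj.
    by exists (x, exist _ y Vy); apply: sval_inj.
  - move=> n [x [y Vy]] [[x' Ux'] y'] /(congr1 sval) /= [xE yE]; subst x' y'.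
    by exists (exist _ x Ux', exist _ y Vy).
  - by move=> n [x y] [x' y'] /(congr1 sval) /= [-> /sval_inj ->]; left.
have [_ jW] := acof_po po (acof_prod (ssub V) UA).
apply: weq_cancel_l jW _; have [_] := acof_prod D UA.
by congr weak_equiv; apply: smap_ext.
Qed.

(** * The diagonal lemma *)

Section Degeneracy.
Variables (m j : nat) (jm : j <= m).

Lemma sdeg_leq (x y : 'I_m.+2) : x <= y ->
  (inord (if x <= j then x : nat else x.-1) : 'I_m.+1) <=
  (inord (if y <= j then y : nat else y.-1) : 'I_m.+1).
Proof. exact: prism1_leq. Qed.

Definition sdeg : mono m.+1 m := mk_mono sdeg_leq.

Lemma sdegE x : sdeg x = (if x <= j then x : nat else x.-1) :> nat.
Proof.
rewrite mk_monoE inordK //; have := ltn_ord x.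
by case: (leqP x j); lia.
Qed.

Lemma sface_leq (x y : 'I_m.+1) : x <= y ->
  (inord (if x <= j then x : nat else x.+1) : 'I_m.+2) <=
  (inord (if y <= j then y : nat else y.+1) : 'I_m.+2).
Proof.
move=> xy; have := ltn_ord x; have := ltn_ord y.
by case: (leqP x j); case: (leqP y j) => /= *; rewrite !inordK; lia.
Qed.

Definition sface : mono m m.+1 := mk_mono sface_leq.

Lemma sfaceE x : sface x = (if x <= j then x : nat else x.+1) :> nat.
Proof.
rewrite mk_monoE inordK //; have := ltn_ord x.
by case: (leqP x j); lia.
Qed.

Lemma sdeg_sface : mono_comp sdeg sface = mono_id m.
Proof.
apply: mono_ext => x; rewrite mono_compE mono_idE; apply: ord_inj.
by rewrite sdegE sfaceE; case: (leqP x j) => /= H; [rewrite H|case: (leqP x.+1 j); lia].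
Qed.

Lemma sface_sdeg : mono_comp sface sdeg = collapse m.+1 j.
Proof.
apply: mono_ext => x; rewrite mono_compE; apply: ord_inj.
rewrite sfaceE sdegE collapseE; case: (leqP x j) => /= H.
  by rewrite H; case: eqP; lia.
by case: (leqP x.-1 j) => *; case: (eqVneq (nat_of_ord x) j.+1) => *; lia.
Qed.

Lemma collapse_sdeg_sface i : i < j ->
  mono_comp (mono_comp sdeg (collapse m.+1 i)) sface = collapse m i.
Proof.
move=> ij; apply: mono_ext => x; rewrite !mono_compE; apply: ord_inj.
rewrite sdegE !collapseE sfaceE.
case: (eqVneq (nat_of_ord x) i.+1) => [->|ne]; first by rewrite ij eqxx ltnW.
case: (leqP x j) => /= H; first by case: eqP => [|_]; [lia|rewrite H].
by case: eqP => [|_]; [lia|case: leqP; lia].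
Qed.

Lemma collapse_sdeg i : i < j ->
  mono_comp (mono_comp (collapse m i) sdeg) (collapse m.+1 i) =
  mono_comp (collapse m i) sdeg.
Proof.
move=> ij; apply: mono_ext => x; rewrite !mono_compE; apply: ord_inj.
rewrite !collapseE !sdegE !collapseE.
case: (eqVneq (nat_of_ord x) i.+1) => [->|//].
by rewrite (ltnW ij) ij eqxx; case: eqP.
Qed.

End Degeneracy.

Lemma acof_incl_comp W (U V : sub W) (UV : forall n x, U n x -> V n x) :
  acof (incl_le UV) -> acof (incl U) -> acof (incl V).
Proof.
move=> [_ UVW] [_ UW]; split; first exact: incl_inj.
by apply: weq_cancel_l UVW _; move: UW; congr weak_equiv; apply: smap_ext.
Qed.

Section AcyclicBisub.
Variables (T : bisset) (S : bsub T).

Lemma latch_le m j n x : latch S m j n x -> latch S m j.+1 n x.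
Proof. by case=> [|[i [im ij] xE]]; [left|right; exists i => //; lia]. Qed.

Section Step.
Variables (m j : nat) (jm : j <= m).

Definition degen : smap (row T m) (row T m.+1).
refine (@SMap (row T m) (row T m.+1) (fun n y => bact (sdeg jm) (mono_id n) y) _).
by move=> p n b y /=; rewrite -!bact_comp mono_1comp mono_comp1 mono_1comp mono_comp1.
Defined.

Lemma degenK n y : bact (sface jm) (mono_id n) (degen n y) = y.
Proof. by rewrite /= -bact_comp sdeg_sface mono_comp1 bact_id. Qed.

Lemma degen_latch n (y : ssub (latch S m j) n) : latch S m.+1 j n (degen n (sval y)).
Proof.
case: y => y [Sy|[i [im ij] yE]] /=; [left; exact: bsub_act|right; exists i].
  by split=> //; lia.
by rewrite -yE -!bact_comp !mono_comp1 mono_compA collapse_sdeg.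
Qed.

Lemma degen_latchS n y : latch S m.+1 j.+1 n (degen n y).
Proof.
right; exists j; first by split; lia.
rewrite /= -bact_comp mono_comp1 -(sface_sdeg jm) mono_compA sdeg_sface.
by rewrite mono_1comp.
Qed.

(** The degeneracy s_j embeds T_m as the s_j-degenerate simplices of T_(m+1), and s_j y already lies
    in stage j exactly when y lies in stage j of T_m. *)
Lemma latch_po : is_po (incl (latch S m j))
  (@corestr _ (latch S m.+1 j) (ssub (latch S m j)) (smap_comp degen (incl _)) degen_latch)
  (incl_le (@latch_le m.+1 j))
  (@corestr _ (latch S m.+1 j.+1) _ degen degen_latchS).
Proof.
split.
- by move=> n x; apply: sval_inj.
- exact: incl_le_inj.
- move=> n [x Hx]; case: (Hx) => [Sx|[i [im ij] xE]].
    by left; exists (exist _ x (or_introl Sx)); apply: sval_inj.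
  case: (eqVneq i j) => [e|ne]; [subst i; right|left].
    exists (bact (sface jm) (mono_id n) x); apply: sval_inj => /=.
    by rewrite -bact_comp sface_sdeg mono_comp1.
  have Hx' : latch S m.+1 j n x by right; exists i => //; lia.
  by exists (exist _ x Hx'); apply: sval_inj.
- move=> n y [u Hu] /(congr1 sval) /= E; subst u.
  suff Hy : latch S m j n y by exists (exist _ y Hy).
  case: Hu => [Sy|[i [im ij] yE]].
    by left; rewrite -(degenK y); apply: bsub_act.
  right; exists i; first by split=> //; lia.
  rewrite -(collapse_sdeg_sface jm ij) !bact_colcomp.
  by rewrite yE degenK.
- move=> n y y' /(congr1 sval) /= E; left.
  by rewrite -(degenK y) /= E; apply: degenK.
Qed.

End Step.

Hypothesis rowA : forall m, acof (incl (row_sub S m)).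

(** Double induction: stage 0 is the row inclusion, and each further stage is a pushout of a
    latching inclusion one dimension lower. *)
Lemma latch_acof m j : j <= m -> acof (incl (latch S m j)).
Proof.
elim: m j => [|m IHm] j; elim: j => [|j IHj] jm //.
- rewrite (_ : latch S 0 0 = row_sub S 0) //; apply: sub_ext => n x.
  by split=> [[//|[i []]]|]; [lia|left].
- rewrite (_ : latch S m.+1 0 = row_sub S m.+1) //; apply: sub_ext => n x.
  by split=> [[//|[i []]]|]; [lia|left].
- have jm' : j <= m by lia.
  apply: (acof_incl_comp (UV := @latch_le m.+1 j)); last by apply: IHj; lia.
  exact: (acof_po (latch_po jm') (IHm _ jm')).
Qed.

Lemma acof_diag : acof (incl (diag_sub S)).
Proof.
apply/acofP; split=> [|K KK]; first exact: incl_inj.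
have cA m : acof (incl (sbox (latch S m m) (bd m))) by apply: acof_box; apply: latch_acof.
by split; apply: LLP_diag => m; have /acofP [_ /(_ K KK) []] := cA m.
Qed.

End AcyclicBisub.

(** * Maps of bisimplicial sets and their replacement by injections *)

Record bmap (S T : bisset) := BMap {
  bmap_fun :> forall m n, S m n -> T m n;
  bmap_nat : forall m m' n n' (a : mono m m') (b : mono n n') x,
    bmap_fun (bact a b x) = bact a b (bmap_fun x) }.

Arguments bmap_fun {S T} _ m n _.

Definition brow S T (f : bmap S T) m : smap (row S m) (row T m) :=
  @SMap (row S m) (row T m) (fun n x => f m n x) (fun _ _ b x => bmap_nat f (mono_id m) b x).

Definition bdiag S T (f : bmap S T) : smap (diag S) (diag T) :=
  @SMap (diag S) (diag T) (fun n x => f n n x) (fun _ _ a x => bmap_nat f a a x).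

Lemma weq_bij X Y (f : smap X Y) :
  sinj f -> (forall n y, exists x, y = f n x) -> weak_equiv f.
Proof.
move=> fI fS; have [g gP] : exists g : smap Y X, forall n y, y = f n (g n y).
  apply: (@smap_of_rel Y X (fun n y x => y = f n x)) => //.
  - by move=> n y x x' -> /fI.
  - by move=> m n a y x ->; rewrite smap_nat.
by apply: (@weq_iso _ _ f g) => n x; [apply: fI|]; rewrite -gP.
Qed.

Section Cofree.
Variable S : bisset.

Definition cofree_simp m n := forall k, mono k n -> option (S m k).

Definition cofree_act m m' n n' (a : mono m m') (b : mono n n') (c : cofree_simp m' n') :
    cofree_simp m n :=
  fun k d => omap (bact a (mono_id k)) (c k (mono_comp b d)).

Lemma cofree_ext m n (c c' : cofree_simp m n) : (forall k d, c k d = c' k d) -> c = c'.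
Proof. by move=> E; apply: functional_extensionality_dep => k; apply/funext => d. Qed.

Lemma cofree_act_id m n c : cofree_act (mono_id m) (mono_id n) c = c.
Proof.
apply: cofree_ext => k d; rewrite /cofree_act mono_1comp.
by case: (c k d) => //= x; rewrite bact_id.
Qed.

Lemma cofree_act_comp m m' m'' n n' n'' (a' : mono m' m'') (a : mono m m')
    (b' : mono n' n'') (b : mono n n') c :
  cofree_act (mono_comp a' a) (mono_comp b' b) c = cofree_act a b (cofree_act a' b' c).
Proof.
apply: cofree_ext => k d; rewrite /cofree_act mono_compA.
by case: (c k _) => //= x; rewrite -bact_comp mono_comp1.
Qed.

(* The cofree object on the pointed family n |-> option (S m n): it contains  *)
(* S and is contractible.                                                     *)
Definition cofree : bisset := BiSSet cofree_act_id cofree_act_comp.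

End Cofree.

Section BProd.
Variables S T : bisset.

Definition bprod_act m m' n n' (a : mono m m') (b : mono n n') (x : S m' n' * T m' n') :
    S m n * T m n :=
  (bact a b x.1, bact a b x.2).

Lemma bprod_act_id m n x : bprod_act (mono_id m) (mono_id n) x = x.
Proof. by case: x => x y; rewrite /bprod_act !bact_id. Qed.

Lemma bprod_act_comp m m' m'' n n' n'' (a' : mono m' m'') (a : mono m m')
    (b' : mono n' n'') (b : mono n n') x :
  bprod_act (mono_comp a' a) (mono_comp b' b) x = bprod_act a b (bprod_act a' b' x).
Proof. by rewrite /bprod_act !bact_comp. Qed.

Definition bprod : bisset := BiSSet bprod_act_id bprod_act_comp.

End BProd.

Section MonoReplacement.
Variables (S T : bisset) (f : bmap S T).
Let TJ := bprod T (cofree S).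

Definition bpr : bmap TJ T :=
  @BMap TJ T (fun _ _ x => x.1) (fun _ _ _ _ _ _ _ => erefl).

Definition bsec : bmap T TJ :=
  @BMap T TJ (fun m n x => (x, fun _ _ => None)) (fun _ _ _ _ _ _ _ => erefl).

Lemma bemb_nat m m' n n' (a : mono m m') (b : mono n n') (x : S m' n') :
  (f m n (bact a b x), (fun k d => Some (bact (mono_id m) d (bact a b x))) : cofree S m n) =
  @bact TJ _ _ _ _ a b (f m' n' x, fun k d => Some (bact (mono_id m') d x)).
Proof.
congr (_, _); first exact: bmap_nat.
apply: cofree_ext => k d; rewrite /= /cofree_act /=.
by rewrite -!bact_comp mono_1comp mono_comp1 mono_comp1.
Qed.

Definition bemb : bmap S TJ :=
  @BMap S TJ (fun m n x => (f m n x, fun k d => Some (bact (mono_id m) d x))) bemb_nat.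

(** A contraction in the second direction: values survive on the part where t is 1, and the base
    point [None] is put elsewhere. *)
Definition contr m n (t : mono n 1) (c : cofree S m n) : cofree S m n :=
  fun k d => if pselect (mono_comp t d = mono_const k (vx true)) then c k d else None.

Lemma contr_nat m m' n n' (a : mono m m') (b : mono n n') t (c : cofree S m' n') :
  contr (mono_comp t b) (bact a b c) = bact a b (contr t c).
Proof.
apply: cofree_ext => k d; rewrite /= /cofree_act /contr /= mono_compA.
by case: pselect.
Qed.

Lemma contr0 m n (c : cofree S m n) :
  contr (mono_const n (vx false)) c = fun _ _ => None.
Proof.
apply: cofree_ext => k d; rewrite /contr mono_const_comp.
by case: pselect => // E; case: (@vx_inj k).
Qed.

Lemma contr1 m n (c : cofree S m n) : contr (mono_const n (vx true)) c = c.
Proof.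
by apply: cofree_ext => k d; rewrite /contr mono_const_comp; case: pselect.
Qed.

Lemma brow_pr_weq m : weak_equiv (brow bpr m).
Proof.
apply: (@weq_hequiv _ _ _ (brow bsec m)); last first.
  by rewrite (_ : smap_comp _ _ = smap_id _); [apply: rst_refl|apply: smap_ext].
apply: rst_step.
have cnat k n (b : mono k n) (p : sprod (row TJ m) I1 n) :
    ((act b p).1.1, contr (act b p).2 (act b p).1.2) =
    act (s := row TJ m) b (p.1.1, contr p.2 p.1.2).
  by congr (_, _); apply: contr_nat.
exists (@SMap (sprod (row TJ m) I1) (row TJ m)
  (fun n p => (p.1.1, contr p.2 p.1.2)) cnat) => n [x c]; split; congr (_, _); [exact: contr0|exact: contr1].
Qed.

Lemma bdiag_pr_weq : weak_equiv (bdiag bpr).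
Proof.
apply: (@weq_hequiv _ _ _ (bdiag bsec)); last first.
  by rewrite (_ : smap_comp _ _ = smap_id _); [apply: rst_refl|apply: smap_ext].
apply: rst_step.
have cnat k n (b : mono k n) (p : sprod (diag TJ) I1 n) :
    ((act b p).1.1, contr (act b p).2 (act b p).1.2) =
    act (s := diag TJ) b (p.1.1, contr p.2 p.1.2).
  by congr (_, _); apply: contr_nat.
exists (@SMap (sprod (diag TJ) I1) (diag TJ)
  (fun n p => (p.1.1, contr p.2 p.1.2)) cnat) => n [x c]; split; congr (_, _); [exact: contr0|exact: contr1].
Qed.

Lemma bemb_inj m n : injective (bemb m n).
Proof.
move=> x y /(congr1 (fun p : TJ m n => p.2 n (mono_id n))) /= [].
by rewrite !bact_id.
Qed.

Lemma bemb_img_act m m' n n' (a : mono m m') (b : mono n n') (x : TJ m' n') :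
  (exists y, x = bemb m' n' y) -> exists y, bact a b x = bemb m n y.
Proof. by case=> y ->; exists (bact a b y); rewrite bmap_nat. Qed.

Definition bemb_img : bsub TJ :=
  @BSub TJ (fun m n x => exists y, x = bemb m n y) bemb_img_act.

(** f is [bemb] followed by [bpr], and [bpr] is a homotopy equivalence on rows and on the diagonal.
    By two out of three [bemb] is acyclic on rows, so [acof_diag] applies to its image. *)
Theorem weq_diag : (forall m, weak_equiv (brow f m)) -> weak_equiv (bdiag f).
Proof.
move=> fW.
have imgE W (U : sub W) X (g : smap X W) (gU : forall n x, U n (g n x)) :
    sinj g -> (forall n y, U n y -> exists x, y = g n x) -> weak_equiv (corestr gU).
  move=> gI gS; apply: weq_bij => n.
    by move=> x y /(congr1 sval) /= /gI.
  by case=> y Uy; have [x yE] := gS n y Uy; exists x; apply: sval_inj.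
have rowU m n x : row_sub bemb_img m n (brow bemb m n x) by exists x.
have diagU n x : diag_sub bemb_img n (bdiag bemb n x) by exists x.
have A : acof (incl (diag_sub bemb_img)).
  apply: acof_diag => m; split; first exact: incl_inj.
  have cW : weak_equiv (corestr (rowU m)).
    by apply: imgE => // n x y; apply: bemb_inj.
  apply: weq_cancel_l cW _; apply: weq_cancel_r (brow_pr_weq m) _.
  by move: (fW m); congr weak_equiv; apply: smap_ext.
have cW : weak_equiv (corestr diagU).
  by apply: imgE => // n x y; apply: bemb_inj.
have := weq_comp (weq_comp cW A.2) bdiag_pr_weq.
by congr weak_equiv; apply: smap_ext.
Qed.

End MonoReplacement.

(** * Coproducts *)

Record is_coprod I (A_ : I -> sset) A (a : forall i, smap (A_ i) A) := IsCoprod {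
  cop_cover : forall n x, exists i y, x = a i n y;
  cop_inj : forall n i y i' y', a i n y = a i' n y' ->
    existT (fun i => A_ i n) i y = existT (fun i => A_ i n) i' y' }.

Lemma cop_glue I (A_ : I -> sset) A (a : forall i, smap (A_ i) A) K
    (u : forall i, smap (A_ i) K) : is_coprod a ->
  exists f : smap A K, forall i n x, f n (a i n x) = u i n x.
Proof.
move=> aC.
have Rfun n i y i' y' : a i n y = a i' n y' -> u i n y = u i' n y'.
  by move/(cop_inj aC)/(congr1 (fun p => u (projT1 p) n (projT2 p))).
have [f fP] : exists f : smap A K, forall n x,
    exists i y, x = a i n y /\ f n x = u i n y.
  apply: (@smap_of_rel A K (fun n x z => exists i y, x = a i n y /\ z = u i n y)).
  - by move=> n x; have [i [y xE]] := cop_cover aC x; exists (u i n y), i, y.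
  - by move=> n x z z' [i [y [-> ->]]] [i' [y' [/Rfun E ->]]].
  - move=> m n c x z [i [y [-> ->]]]; exists i, (act c y).
    by rewrite !smap_nat.
exists f => i n x; have [i' [y [/Rfun -> ->]]] := fP n (a i n x); by [].
Qed.

Lemma cop_prod I (A_ : I -> sset) A (a : forall i, smap (A_ i) A) D :
  is_coprod a -> is_coprod (fun i => sprod_map (a i) (smap_id D)).
Proof.
move=> aC; split=> [n [x d]|n i [y d] i' [y' d']] /=.
  by have [i [y ->]] := cop_cover aC x; exists i, (y, d).
case=> /(cop_inj aC) E ->.
exact: (congr1 (fun p => existT (fun i => sprod (A_ i) D n) (projT1 p) (projT2 p, d')) E).
Qed.

(** Maps and homotopies are chosen on each summand and glued; for homotopies, the product with I
    preserves coproducts. *)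
Lemma weq_coprod I (A_ B_ : I -> sset) A B (a : forall i, smap (A_ i) A)
    (b : forall i, smap (B_ i) B) (f : smap A B) (f_ : forall i, smap (A_ i) (B_ i)) :
  is_coprod a -> is_coprod b -> (forall i n x, f n (a i n x) = b i n (f_ i n x)) ->
  (forall i, weak_equiv (f_ i)) -> weak_equiv f.
Proof.
move=> aC bC fab fW; apply/weqP => K KK; split=> [v w [H HE]|u].
  have ex i : exists G : smap (sprod (B_ i) I1) K, forall n x,
      G n (x, mono_const n ord0) = v n (b i n x) /\
      G n (x, mono_const n ord_max) = w n (b i n x).
    have /weqP /(_ K KK) [inj _] := fW i.
    have [|G GE] := inj (smap_comp v (b i)) (smap_comp w (b i)); last by exists G.
    exists (smap_comp H (sprod_map (a i) (smap_id I1))) => n x /=.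
    by have [-> ->] := HE n (a i n x); rewrite /= fab.
  have [G GE] := cop_glue (fun i => sval (cid (ex i))) (cop_prod I1 bC).
  exists G => n y; have [i [x ->]] := cop_cover bC y.
  have /= E0 := GE i n (x, mono_const n ord0).
  have /= E1 := GE i n (x, mono_const n ord_max).
  by rewrite E0 E1; case: cid => g /= /(_ n x).
have ex i : exists p : smap (B_ i) K * smap (sprod (A_ i) I1) K, forall n x,
    p.2 n (x, mono_const n ord0) = p.1 n (f_ i n x) /\
    p.2 n (x, mono_const n ord_max) = u n (a i n x).
  have /weqP /(_ K KK) [_ sur] := fW i.
  by have [v [G GE]] := sur (smap_comp u (a i)); exists (v, G).
have [v vE] := cop_glue (fun i => (sval (cid (ex i))).1) bC.
have [G GE] := cop_glue (fun i => (sval (cid (ex i))).2) (cop_prod I1 aC).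
exists v, G => n y; have [i [x ->]] := cop_cover aC y.
have /= E0 := GE i n (x, mono_const n ord0).
have /= E1 := GE i n (x, mono_const n ord_max).
by rewrite E0 E1 fab vE; case: cid => p /= /(_ n x).
Qed.

(** * The bisimplicial set of slices *)

Definition btr (T : bisset) : bisset :=
  @BiSSet (fun m n => T n m) (fun _ _ _ _ a b x => bact b a x)
    (fun m n x => bact_id x) (fun _ _ _ _ _ _ a' a b' b x => bact_comp b' b a' a x).

Section Slices.
Variables (X Z : sset) (g : smap X Z).

Definition slices_simp m n :=
  {p : X n * Z (m + n.+1) | act (back m n) p.2 = g n p.1}.

Lemma slices_act_back m m' n n' (a : mono m m') (b : mono n n') (p : slices_simp m' n') :
  act (back m n) (act (mono_join a b) (sval p).2) = g n (act b (sval p).1).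
Proof. by rewrite -act_comp join_back act_comp (svalP p) smap_nat. Qed.

Definition slices_act m m' n n' (a : mono m m') (b : mono n n')
    (p : slices_simp m' n') : slices_simp m n :=
  exist _ (act b (sval p).1, act (mono_join a b) (sval p).2) (slices_act_back a b p).

Lemma slices_act_id m n p : slices_act (mono_id m) (mono_id n) p = p.
Proof.
by apply: sval_inj; rewrite /= join_id !act_id; case: p => [[]].
Qed.

Lemma slices_act_comp m m' m'' n n' n'' (a' : mono m' m'') (a : mono m m')
    (b' : mono n' n'') (b : mono n n') p :
  slices_act (mono_comp a' a) (mono_comp b' b) p = slices_act a b (slices_act a' b' p).
Proof. by apply: sval_inj; rewrite /= join_comp !act_comp. Qed.

Definition slices : bisset := BiSSet slices_act_id slices_act_comp.

Definition slice_in m (z : Z m) : smap (slice g z) (row slices m).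
refine (@SMap (slice g z) (row slices m)
  (fun n s => exist _ (sl_x s, sl_z s) (sl_back s)) _).
by move=> p n a s; apply: sval_inj.
Defined.

Lemma slice_in_coprod m : is_coprod (@slice_in m).
Proof.
split=> [n [[x z'] /= E]|n z s w t /(congr1 sval) /= [Ex Ez]].
  exists (act (front m n) z'), (@SliceSimplex X Z g m _ n x z' erefl E).
  exact: sval_inj.
have zw : z = w by rewrite -(sl_front s) Ez sl_front.
by subst w; rewrite (slice_ext Ex Ez).
Qed.

Definition slices_proj : bmap (btr slices) (bconst X).
refine (@BMap (btr slices) (bconst X) (fun n m p => (sval p).1) _).
by [].
Defined.

Section Column.
Variable n : nat.

Definition squeeze_fun m (i : 'I_(m.+1 + n.+1)) : 'I_n.+1 :=
  match split i with inl _ => ord0 | inr j => j end.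

Lemma squeeze_leq m (i j : 'I_(m.+1 + n.+1)) : i <= j -> squeeze_fun i <= squeeze_fun j.
Proof.
rewrite /squeeze_fun; case: splitP => k ->; case: splitP => l -> //=; last by lia.
by have := ltn_ord l; lia.
Qed.

Definition squeeze m : mono (m + n.+1) n := @mk_mono (m + n.+1) n _ (@squeeze_leq m).

Lemma squeeze_lshift m j : squeeze m (@lshift m.+1 n.+1 j) = ord0.
Proof. by rewrite mk_monoE /squeeze_fun (unsplitK (inl j)). Qed.

Lemma squeeze_rshift m j : squeeze m (@rshift m.+1 n.+1 j) = j.
Proof. by rewrite mk_monoE /squeeze_fun (unsplitK (inr j)). Qed.

Lemma squeeze_back m : mono_comp (squeeze m) (back m n) = mono_id n.
Proof.
by apply: mono_ext => j; rewrite mono_compE backE squeeze_rshift mono_idE.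
Qed.

Lemma squeeze_join m m' (a : mono m m') :
  mono_comp (squeeze m') (mono_join a (mono_id n)) = squeeze m.
Proof.
apply: mono_ext => i; rewrite mono_compE mono_joinE.
case: (@split_ordP m.+1 n.+1 i) => j ->; rewrite ?join_lshift ?join_rshift.
  by rewrite !squeeze_lshift.
by rewrite !squeeze_rshift mono_idE.
Qed.

(** Front vertices where t is 1 move to the first back vertex: a homotopy from the identity to
    [squeeze] followed by [back]. *)
Definition push_fun m (t : mono m 1) (i : 'I_(m.+1 + n.+1)) : 'I_(m.+1 + n.+1) :=
  match split i with
  | inl j => if t j == ord0 then lshift n.+1 j else rshift m.+1 ord0
  | inr j => rshift m.+1 j
  end.

Lemma push_leq m (t : mono m 1) (i j : 'I_(m.+1 + n.+1)) : i <= j -> push_fun t i <= push_fun t j.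
Proof.
rewrite /push_fun; case: splitP => k ->; case: splitP => l -> kl //=.
- have := mono_leq t kl; rewrite -!val_eqE /=.
  by have := ltn_ord k; case: eqP; case: eqP => /=; lia.
- by have := ltn_ord k; case: eqP => /=; lia.
- by have := ltn_ord l; lia.
Qed.

Definition push m (t : mono m 1) : mono (m + n.+1) (m + n.+1) :=
  @mk_mono (m + n.+1) (m + n.+1) _ (@push_leq m t).

Lemma push_lshift m (t : mono m 1) j :
  push t (@lshift m.+1 n.+1 j) = if t j == ord0 then lshift n.+1 j else rshift m.+1 ord0.
Proof. by rewrite mk_monoE /push_fun (unsplitK (inl j)). Qed.

Lemma push_rshift m (t : mono m 1) j : push t (@rshift m.+1 n.+1 j) = rshift m.+1 j.
Proof. by rewrite mk_monoE /push_fun (unsplitK (inr j)). Qed.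

Lemma push_back m (t : mono m 1) : mono_comp (push t) (back m n) = back m n.
Proof. by apply: mono_ext => j; rewrite mono_compE !backE push_rshift. Qed.

Lemma push_join m m' (a : mono m m') (t : mono m' 1) :
  mono_comp (push t) (mono_join a (mono_id n)) =
  mono_comp (mono_join a (mono_id n)) (push (mono_comp t a)).
Proof.
apply: mono_ext => i; rewrite !mono_compE mono_joinE.
case: (@split_ordP m.+1 n.+1 i) => j ->; rewrite ?join_lshift ?join_rshift.
  rewrite !push_lshift mono_compE.
  by case: eqP => _; rewrite mono_joinE ?join_lshift ?join_rshift ?mono_idE.
by rewrite !push_rshift mono_joinE join_rshift.
Qed.

Lemma push0 m : push (mono_const m ord0) = mono_id (m + n.+1).
Proof.
apply: mono_ext => i; rewrite mono_idE.
by case: (@split_ordP m.+1 n.+1 i) => j ->; rewrite ?push_lshift ?push_rshift ?mono_constE.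
Qed.

Lemma push1 m : push (mono_const m ord_max) = mono_comp (back m n) (squeeze m).
Proof.
apply: mono_ext => i; rewrite mono_compE backE.
case: (@split_ordP m.+1 n.+1 i) => j ->; rewrite ?push_lshift ?push_rshift ?mono_constE.
  by rewrite squeeze_lshift.
by rewrite squeeze_rshift.
Qed.

(* Doubling the first vertex of x is an extra degeneracy of the augmented     *)
(* simplicial set of all (x, z'), for x of fixed dimension n.                 *)
Lemma slices_proj_weq : weak_equiv (brow slices_proj n).
Proof.
have secP m (x : X n) : act (back m n) (act (squeeze m) (g n x)) = g n x.
  by rewrite -act_comp squeeze_back act_id.
pose sec_fun m (x : row (bconst X) n m) : row (btr slices) n m :=
  exist _ (x, act (squeeze m) (g n x)) (secP m x).
have sec_nat m m' (a : mono m m') x : sec_fun m (act a x) = act a (sec_fun m' x).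
  by apply: sval_inj; rewrite /= act_id -act_comp squeeze_join.
pose sec : smap (row (bconst X) n) (row (btr slices) n) := SMap sec_nat.
apply: (@weq_hequiv _ _ _ sec); last first.
  by rewrite (_ : smap_comp _ _ = smap_id _); [apply: rst_refl|apply: smap_ext].
apply: rst_sym; apply: rst_step.
have homP m (p : sprod (row (btr slices) n) I1 m) :
    act (back m n) (act (push p.2) (sval p.1).2) = g n (sval p.1).1.
  by rewrite -act_comp push_back (svalP p.1).
pose hom_fun m (p : sprod (row (btr slices) n) I1 m) : row (btr slices) n m :=
  exist _ ((sval p.1).1, act (push p.2) (sval p.1).2) (homP m p).
have hom_nat m m' (a : mono m m') p : hom_fun m (act a p) = act a (hom_fun m' p).
  by apply: sval_inj; rewrite /= -!act_comp push_join.
exists (SMap hom_nat).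
move=> m [[x z'] /= E]; split; apply: sval_inj => /=.
  by rewrite push0 act_id.
by rewrite push1 act_comp E.
Qed.

End Column.

Lemma slices_diag_weq : weak_equiv (bdiag slices_proj).
Proof. by apply: weq_diag => n; apply: slices_proj_weq. Qed.

End Slices.

(** * From slices to the theorem *)

Section SlicesMap.
Variables (X Y Z : sset) (f : smap X Y) (g : smap X Z) (h : smap Y Z).
Hypothesis fgh : over f g h.

Lemma slices_map_back m n (p : slices_simp g m n) :
  act (back m n) (sval p).2 = h n (f n (sval p).1).
Proof. by rewrite (svalP p) fgh. Qed.

Definition slices_map : bmap (slices g) (slices h).
refine (@BMap (slices g) (slices h)
  (fun m n p => exist _ (f n (sval p).1, (sval p).2) (slices_map_back p)) _).
by move=> m m' n n' a b p; apply: sval_inj; rewrite /= smap_nat.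
Defined.

Theorem weq_of_slices :
  (forall m (z : Z m), weak_equiv (slice_map fgh z)) -> weak_equiv f.
Proof.
move=> W.
have rowW m : weak_equiv (brow slices_map m).
  apply: (weq_coprod (@slice_in_coprod _ _ g m) (@slice_in_coprod _ _ h m) _ (W m)) => z n s.
  exact: sval_inj.
have diagW := weq_diag rowW.
pose df := @SMap (diag (bconst X)) (diag (bconst Y)) f (@smap_nat _ _ f).
have dfW : weak_equiv df.
  apply: weq_cancel_l (@slices_diag_weq _ _ g) _.
  by have := weq_comp diagW (@slices_diag_weq _ _ h); congr weak_equiv; apply: smap_ext.
(* The diagonal of [bconst X] has the simplices and operators of X but is another record, so
   identity functions mediate. *)
pose iX := @SMap X (diag (bconst X)) (fun _ x => x) (fun _ _ _ _ => erefl).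
pose jY := @SMap (diag (bconst Y)) Y (fun _ x => x) (fun _ _ _ _ => erefl).
have iW : weak_equiv iX by apply: weq_bij => [n x y|n y] //; exists y.
have jW : weak_equiv jY by apply: weq_bij => [n x y|n y] //; exists y.
by have := weq_comp (weq_comp iW dfW) jW; congr weak_equiv; apply: smap_ext.
Qed.

(** Two out of three in the square comparing the slices under z with those under its last vertex. *)
Lemma slice_map_vertex m (z : Z m) :
  weak_equiv (slice_vertex g z) -> weak_equiv (slice_vertex h z) ->
  weak_equiv (slice_map fgh (last_vertex z)) -> weak_equiv (slice_map fgh z).
Proof.
move=> gW hW fW; apply: weq_cancel_r hW _.
have := weq_comp gW fW; congr weak_equiv; apply: smap_ext => n s.
exact: slice_ext.
Qed.

End SlicesMap.

Theorem mainTheorem4 (C : category) (O : functor Delta C)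
  (HO : permits_theorem_A O)
  (X Y Z : C) (f : Hom X Y) (g : Hom X Z) (h : Hom Y Z)
  (hf : compc h f = g)
  (Hslice : forall z : nerve O Z 0,
    weak_equiv (slice_map (nerve_over (O := O) hf) z)) :
  cweak_equiv O f.
Proof.
apply: (weq_of_slices (fgh := nerve_over (O := O) hf)) => m z.
by apply: slice_map_vertex; [apply: HO|apply: HO|apply: Hslice].
Qed.
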